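(* Let $\mu\in\mathfrak M^{\rm df}_{\bar n}(\mathfrak C,M)$ be idempotent (i.e. $\mu*\mu=\mu$) with $\mathrm{supp}(\mu)\subseteq S^{\rm inv}_{\bar n}(\mathfrak C,M)$. Then the following are equivalent: (1) $\mathrm{supp}(\mu)\subseteq\mathrm{stab}_r(\mu)$; (2) $\mathrm{supp}(\mu)$ (as a semigroup under $*$) is left-simple, equivalently it has a unique minimal left ideal $L$ (and then $\mathrm{supp}(\mu)=L$).
   Context: $T$ is a complete first-order theory, $\mathfrak C$ a monster model, $\mathfrak C'\succeq\mathfrak C$ a larger monster model. Fix small $M\preceq N\preceq\mathfrak C$ with enumerations $\bar m\subseteq\bar n$, $\bar x$ the variable tuple for $\bar n$. $S_{\bar n}(\mathfrak C)$ is the set of global types extending $\mathrm{tp}(\bar n/\emptyset)$, each $\mathrm{tp}(\sigma(\bar n)/\mathfrak C)$ for some $\sigma\in\mathrm{Aut}(\mathfrak C')$; $S^{\rm inv}_{\bar n}(\mathfrak C,M)$ the $M$-invariant ones; $\mathfrak M^{\rm df}_{\bar n}(\mathfrak C,M)$ the $M$-definable Keisler measures concentrated on $S_{\bar n}(\mathfrak C)$. For $M$-invariant $p$ (resp. Borel-definable $M$-invariant $\mu$), $p|_{\mathfrak C'}$ ($\mu|_{\mathfrak C'}$) is the unique $M$-invariant extension to $\mathfrak C'$. $*$-product: for $q=\mathrm{tp}(\tau(\bar n)/\mathfrak C)$, $\tau\in\mathrm{Aut}(\mathfrak C')$, $p*q=(\tau\cdot p|_{\mathfrak C'})|_{\mathfrak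 C}$, $\mu*q=(\tau\cdot\mu|_{\mathfrak C'})|_{\mathfrak C}$, and $(\mu*\nu)(\varphi)=\int(\mu*q)(\varphi)\,d\nu(q)$. For idempotent $\mu$ as in the claim, $\mathrm{supp}(\mu)$ is a compact left-continuous subsemigroup of $(S^{\rm inv}_{\bar n}(\mathfrak C,M),* )$. $\mathrm{stab}_r(\mu)=\{q\in S_{\bar n}(\mathfrak C):\mu*q=\mu\}$. Left-simple: no proper left ideals. *)

(* Defs.v *)
From HB Require Import structures.
From mathcomp Require Import all_boot all_order all_algebra.
From mathcomp Require Import all_classical all_reals all_analysis.
Import Order.TTheory GRing.Theory Num.Theory.
Import numFieldNormedType.Exports.

Set Implicit Arguments.
Unset Strict Implicit.
Unset Printing Implicit Defensive.

Local Open Scope classical_set_scope.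
Local Open Scope ring_scope.

Record language := Language {
  fsym : Type; farity : fsym -> nat;
  rsym : Type; rarity : rsym -> nat }.

Inductive term (L : language) (V : Type) : Type :=
| tVar of V
| tApp (f : fsym L) of ('I_(farity f) -> term L V).

(* [fo L V] is the set of L-formulas with free variables in [V]; a quantifier
   binds the variable [None]. *)
Inductive fo (L : language) (V : Type) : Type :=
| fEq of term L V & term L V
| fRel (r : rsym L) of ('I_(rarity r) -> term L V)
| fFalse
| fImp of fo L V & fo L V
| fForall of fo L (option V).

Arguments fFalse {L V}.

Definition fNot L (V : Type) (a : fo L V) := fImp a fFalse.
Definition fTrue L (V : Type) : fo L V := fNot fFalse.
Definition fOr L (V : Type) (a b : fo L V) := fImp (fNot a) b.
Definition fAnd L (V : Type) (a b : fo L V) := fNot (fImp a (fNot b)).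

Arguments fTrue {L V}.

Fixpoint tren L (V W : Type) (f : V -> W) (t : term L V) : term L W :=
  match t with
  | tVar v => tVar L (f v)
  | tApp g ts => tApp (fun i => tren f (ts i))
  end.

Fixpoint fren L (V W : Type) (f : V -> W) (a : fo L V) : fo L W :=
  match a with
  | fEq s t => fEq (tren f s) (tren f t)
  | fRel r ts => fRel (fun i => tren f (ts i))
  | fFalse => fFalse
  | fImp b c => fImp (fren f b) (fren f c)
  | fForall b => fForall (fren (omap f) b)
  end.

(* The distinguished point only witnesses nonemptiness; it is not part of the
   language. *)
Record structure (L : language) := Structure {
  carrier :> pointedType;
  fint : forall f : fsym L, ('I_(farity f) -> carrier) -> carrier;
  rint : forall r : rsym L, ('I_(rarity r) -> carrier) -> Prop }.

Fixpoint teval L (S : structure L) (V : Type) (e : V -> S) (t : term L V) : S :=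
  match t with
  | tVar v => e v
  | tApp f ts => fint (fun i => teval e (ts i))
  end.

Definition scons (S V : Type) (x : S) (e : V -> S) (o : option V) : S :=
  if o is Some v then e v else x.

(* Satisfaction in the substructure with universe [D]. *)
Fixpoint sat L (S : structure L) (D : set S) (V : Type) (a : fo L V) (e : V -> S) :
    Prop :=
  match a with
  | fEq s t => fun e => teval e s = teval e t
  | fRel r ts => fun e => rint (fun i => teval e (ts i))
  | fFalse => fun _ => False
  | fImp b c => fun e => sat D b e -> sat D c e
  | fForall b => fun e => forall x, D x -> sat D b (scons x e)
  end e.

Definition holds L (S : structure L) (V : Type) (a : fo L V) (e : V -> S) :=
  sat [set: S] a e.

Definition fun_closed L (S : structure L) (A : set S) :=
  forall (f : fsym L) (a : 'I_(farity f) -> S),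
    (forall i, A (a i)) -> A (fint a).

(* [A] and [B] are universes of substructures of [S] and the first of these is
   an elementary substructure of the second. *)
Definition elementary_sub L (S : structure L) (A B : set S) :=
  [/\ A `<=` B, fun_closed A, fun_closed B &
   forall (V : Type) (a : fo L V) (e : V -> S),
     (forall v, A (e v)) -> (sat A a e <-> sat B a e)].

Definition elementary_embedding L (S S' : structure L) (i : S -> S') :=
  forall (V : Type) (a : fo L V) (e : V -> S), holds a e <-> holds a (i \o e).

Definition models L (S : structure L) (T : set (fo L void)) :=
  forall a, T a -> holds a (of_void S).

Definition entails L (T : set (fo L void)) (a : fo L void) :=
  forall S : structure L, models S T -> holds a (of_void S).

Definition complete_theory L (T : set (fo L void)) :=
  (exists S : structure L, models S T) /\
  (forall a, entails T a \/ entails T (fNot a)).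

Record auto L (S : structure L) := Auto {
  afun :> S -> S;
  ainv : S -> S;
  afunK : cancel afun ainv;
  ainvK : cancel ainv afun;
  auto_fint : forall (f : fsym L) (a : 'I_(farity f) -> S),
    afun (fint a) = fint (afun \o a);
  auto_rint : forall (r : rsym L) (a : 'I_(rarity r) -> S),
    rint a <-> rint (afun \o a) }.

HB.instance Definition _ L (S : structure L) := gen_eqMixin (auto S).
HB.instance Definition _ L (S : structure L) := gen_choiceMixin (auto S).

Definition auto_id L (S : structure L) : auto S :=
  @Auto L S id id (fun=> erefl) (fun=> erefl)
    (fun _ _ => erefl) (fun _ _ => iff_refl _).

Definition fixes L (S : structure L) (A : set S) (s : auto S) :=
  forall a, A a -> s a = a.

(* [fo L (X + P)] is the set of formulas in the variables [X] with parameters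
   named by [P]; the map [par : P -> S] interprets the parameters. *)
Definition env (X P S : Type) (b : X -> S) (par : P -> S) (v : X + P) : S :=
  match v with inl x => b x | inr c => par c end.

Definition parmap L (X P Q : Type) (f : P -> Q) (a : fo L (X + P)) : fo L (X + Q) :=
  fren (fun v => match v with inl x => inl x | inr c => inr (f c) end) a.

Definition is_type L (S : structure L) (X P : Type) (par : P -> S)
    (p : set (fo L (X + P))) :=
  (forall n (s : 'I_n -> fo L (X + P)), (forall i, p (s i)) ->
     exists b : X -> S, forall i, holds (s i) (env b par)) /\
  (forall a, p a \/ p (fNot a)).

Record stype L (S : structure L) (X P : Type) (par : P -> S) := SType {
  st_set :> fo L (X + P) -> Prop;
  st_is_type : is_type par st_set }.

Arguments stype {L S} X {P} par.

Definition realizes L (S : structure L) (X P : Type) (par : P -> S)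
    (b : X -> S) (p : fo L (X + P) -> Prop) :=
  forall a, p a <-> holds a (env b par).

Lemma tp_is_type L (S : structure L) (X P : Type) (par : P -> S) (b : X -> S) :
  is_type par (fun a : fo L (X + P) => holds a (env b par)).
Proof.
split; first by move=> n s sh; exists b.
by move=> a; case: (pselect (holds a (env b par))) => h; [left|right].
Qed.

Definition tp L (S : structure L) (X P : Type) (par : P -> S) (b : X -> S) :
    stype X par :=
  SType (tp_is_type par b).

Section TypeSpace.
Context {L : language} {S : structure L} {X P : Type} {par : P -> S}.
Local Notation ST := (stype X par).

Definition cyl (a : fo L (X + P)) : set ST := [set p : ST | p a].

Lemma st_true (p : ST) : p fTrue.
Proof.
have [fs] := st_is_type p; case/(_ fFalse) => // pF.
by have [|b /(_ ord0)] := fs 1 (fun=> fFalse).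
Qed.

Lemma st_and (p : ST) (a b : fo L (X + P)) : p (fAnd a b) <-> p a /\ p b.
Proof.
have [fs cp] := st_is_type p.
have incons c d : p c -> p d ->
    (forall e, holds c (env e par) -> holds d (env e par) -> False) -> False.
  move=> pc pd h.
  have [|e he] := fs 2 (fun i => if val i == 0%N then c else d).
    by move=> i; case: ifP.
  by apply: (h e); [exact: (he ord0)|exact: (he ord_max)].
split=> [pab|[pa pb]].
  split.
  - case: (cp a) => // na; exfalso; apply: (incons _ _ pab na) => e.
    rewrite /holds/= => h1 h2; apply: h1 => /h2 [].
  - case: (cp b) => // nb; exfalso; apply: (incons _ _ pab nb) => e.
    rewrite /holds/= => h1 h2; apply: h1 => _ /h2 [].
case: (cp (fAnd a b)) => // nab; exfalso.
have [|e he] := fs 3 (fun i => if val i == 0%N then a else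
                             if val i == 1%N then b else fNot (fAnd a b)).
  by move=> i; case: ifP => // _; case: ifP.
have h0 := he ord0; have h1 := he (lift ord0 ord0); have h2 := he ord_max.
by apply: h2 => h; apply: h.
Qed.

Definition st_open (U : set ST) :=
  forall p, U p -> exists a, p a /\ cyl a `<=` U.

Lemma st_openT : st_open setT.
Proof. by move=> p _; exists fTrue; split; [exact: st_true|]. Qed.

Lemma st_openI : setI_closed st_open.
Proof.
move=> U W oU oW p [/oU[a [pa aU]] /oW[b [pb bW]]].
exists (fAnd a b); split; first exact/st_and.
by move=> q /st_and[qa qb]; split; [exact: aU|exact: bW].
Qed.

Lemma st_open_bigU (I : Type) (f : I -> set ST) :
  (forall i, st_open (f i)) -> st_open (\bigcup_i f i).
Proof.
move=> of_ p [i _ /of_[a [pa af]]]; exists a; split => // q qa.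
by exists i => //; exact: af.
Qed.

HB.instance Definition _ := gen_eqMixin ST.
HB.instance Definition _ := gen_choiceMixin ST.
HB.instance Definition _ := isPointed.Build ST (tp par (fun=> point)).
HB.instance Definition _ :=
  isOpenTopological.Build ST st_openT st_openI st_open_bigU.

End TypeSpace.

Local Open Scope card_scope.

Definition card_lt (A B : Type) : Prop :=
  ([set: A] #<= [set: B]) /\ ~ ([set: B] #<= [set: A]).

(* The cardinal kappa is given by a type [K] of that size. *)
Definition saturated (K : Type) L (S : structure L) :=
  forall A : set S, card_lt A K ->
  forall p : stype unit (@set_val S A), exists c : unit -> S, realizes set_val c p.

Definition strongly_homogeneous (K : Type) L (S : structure L) :=
  forall A : set S, card_lt A K ->
  forall f : A -> S,
    (forall a : fo L A, holds a set_val <-> holds a f) ->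
  exists s : auto S, forall a : A, s (set_val a) = f a.

Definition monster (K : Type) L (S : structure L) :=
  [/\ card_lt (fo L nat) K, saturated K S & strongly_homogeneous K S].

Local Close Scope card_scope.

Notation gtype X S := (@stype _ S X S (@id S)).

Definition type_invariant L (S : structure L) (X : Type) (M : set S) (p : gtype X S) :=
  forall s : auto S, fixes M s -> forall a, p (parmap s a) <-> p a.

Section Keisler.
Context {R : realType} {L : language} {S : structure L} {X : Type}.
Implicit Type mu : fo L (X + S) -> R.

Definition keisler mu :=
  [/\ forall a, 0 <= mu a,
      forall a, (forall b, holds a (env b id)) -> mu a = 1,
      forall a b, (forall e, holds a (env e id) <-> holds b (env e id)) ->
        mu a = mu b
    & forall a b, (forall e, ~ holds (fAnd a b) (env e id)) ->
        mu (fOr a b) = mu a + mu b].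

Definition measure_invariant (M : set S) mu :=
  forall s : auto S, fixes M s -> forall a, mu (parmap s a) = mu a.

(* For every formula a(x, y), y finite, the map b |-> mu(a(x, b)) factors
   through a continuous function on the space of y-types over [M]. *)
Definition definable (M : set S) mu :=
  measure_invariant M mu /\
  forall n (a : fo L (X + 'I_n)),
    exists F : stype 'I_n (@set_val S M) -> R,
      continuous F /\
      forall b : 'I_n -> S, mu (parmap b a) = F (tp set_val b).

Definition supp mu : set (gtype X S) :=
  [set p : gtype X S | forall a, p a -> 0 < mu a].

Definition borel_type := g_sigma_algebraType (@open (gtype X S)).

HB.instance Definition _ := Measurable.on borel_type.

HB.instance Definition _ := gen_eqMixin {measure set borel_type -> \bar R}.
HB.instance Definition _ := gen_choiceMixin {measure set borel_type -> \bar R}.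

Definition regular_measure (P : {measure set borel_type -> \bar R}) :=
  forall A : set borel_type, measurable A ->
    P A = ereal_inf [set P U | U in [set U | @open (gtype X S) U /\ A `<=` U]] /\
    P A = ereal_sup [set P F | F in [set F | @compact (gtype X S) F /\ F `<=` A]].

(* Keisler measures correspond bijectively to regular Borel probability
   measures on the type space; [xget] selects the one corresponding to [mu]. *)
Definition borel_measure mu : {measure set borel_type -> \bar R} :=
  xget (mzero : {measure set borel_type -> \bar R})
    [set P | regular_measure P /\ forall a, P (cyl a) = (mu a)%:E].

End Keisler.

Section Convolution.
Context {R : realType} {L : language} {C C' : structure L}.
Variable iota : C -> C'.
Context {I : Type}.
Variable nbar : I -> C.
Variable M : set C.
Implicit Types (p q : gtype I C) (mu nu : fo L (I + C) -> R).

Definition S_nbar : set (gtype I C) :=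
  [set p : gtype I C | forall a : fo L I, holds a nbar -> p (fren inl a)].

Definition Sinv_nbar : set (gtype I C) :=
  [set p | S_nbar p /\ type_invariant M p].

Definition Mdf_nbar : set (fo L (I + C) -> R) :=
  [set mu | [/\ keisler mu, definable M mu & borel_measure mu S_nbar = 1%E]].

(* Every M-invariant type over C has exactly one M-invariant extension to C',
   and likewise every definable M-invariant measure; [xget] selects it. *)
Definition type_ext p : gtype I C' :=
  xget point [set p' : gtype I C' | type_invariant (iota @` M) p' /\
                forall a, p' (parmap iota a) <-> p a].

Definition measure_ext mu : fo L (I + C') -> R :=
  xget (fun=> 0) [set mu' | [/\ keisler mu', measure_invariant (iota @` M) mu'
                & forall a, mu' (parmap iota a) = mu a]].

(* q = tp(tau(nbar)/C) for the selected tau; the products below do not depend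
   on the selection. *)
Definition realizer q : auto C' :=
  xget (auto_id C')
    [set t : auto C' | realizes iota (t \o iota \o nbar) q].

(* A formula belongs to tau . p' iff its translate by the inverse of tau
   belongs to p'. *)
Definition tmul p q : gtype I C :=
  xget point [set r : gtype I C | forall a,
    r a <-> type_ext p (parmap (ainv (realizer q)) (parmap iota a))].

Definition mtmul mu q : fo L (I + C) -> R :=
  fun a => measure_ext mu (parmap (ainv (realizer q)) (parmap iota a)).

Definition mconv mu nu : fo L (I + C) -> R :=
  fun a => \int[borel_measure nu]_(q in S_nbar) mtmul mu q a.

Definition stab_r mu : set (gtype I C) :=
  [set q | S_nbar q /\ mtmul mu q = mu].

End Convolution.

Section LeftIdeals.
Context {Y : Type}.
Variable mul : Y -> Y -> Y.
Implicit Types A B : set Y.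

Definition left_ideal A B :=
  [/\ B !=set0, B `<=` A & forall s b, A s -> B b -> B (mul s b)].

Definition left_simple A := forall B, left_ideal A B -> B = A.

Definition minimal_left_ideal A B :=
  left_ideal A B /\ forall B', left_ideal A B' -> B' `<=` B -> B' = B.

End LeftIdeals.

(* Main.v *)
Require Import Defs.
From mathcomp Require Import all_boot all_order all_algebra.
From mathcomp Require Import all_classical all_reals all_analysis.

(* Since [mu] is definable, [f_a(q) = (mu * q)(a)] is continuous in [q], and
   idempotence makes [f_a] harmonic: [f_a(q)] is the average of [f_a(p * q)] over
   [p] with respect to [mu]. By the maximum principle the points of the support
   where [f_a] is maximal form a left ideal. If the support is left-simple, this
   ideal is everything, so [f_a] is constant and its value is [(mu * mu)(a)], that
   is [mu(a)]. Conversely, if [mu * q = mu] then [supp(mu) * q] is dense in the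
   support, and it is compact, so each left ideal is the whole support. A unique
   minimal left ideal is closed and two-sided; if it missed a cylinder [a] of
   positive measure, [f_a] would vanish on it, although it meets the left ideal of
   maximizers of [f_a].

   Both products are computed inside the small model: the tuple [c] of parameters
   of a formula is replaced by a tuple [d] of the small model with the type over
   [M] of the preimage of [c] under the automorphism attached to [q]. *)

Import Order.TTheory GRing.Theory Num.Theory.
Import numFieldNormedType.Exports.

Set Implicit Arguments.
Unset Strict Implicit.
Unset Printing Implicit Defensive.

Local Open Scope classical_set_scope.
Local Open Scope card_scope.

(** * Formulas and satisfaction *)

Lemma tren_comp L (V W Z : Type) (g : W -> Z) (f : V -> W) (t : term L V) :
  tren g (tren f t) = tren (g \o f) t.
Proof.
by elim: t => //= h ts IH; congr tApp; apply/funext => i; exact: IH.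
Qed.

Lemma omap_compE (V W Z : Type) (g : W -> Z) (f : V -> W) :
  omap g \o omap f = omap (g \o f).
Proof. by apply/funext; case. Qed.

Lemma fren_comp L (V W Z : Type) (g : W -> Z) (f : V -> W) (a : fo L V) :
  fren g (fren f a) = fren (g \o f) a.
Proof.
elim: a W Z f g => //= {V}.
- by move=> V s t W Z f g; rewrite !tren_comp.
- by move=> V r ts W Z f g; congr fRel; apply/funext => i; rewrite tren_comp.
- by move=> V b IHb c IHc W Z f g; rewrite IHb IHc.
- by move=> V b IHb W Z f g; rewrite IHb omap_compE.
Qed.

Lemma tren_id L (V : Type) (t : term L V) : tren id t = t.
Proof. by elim: t => //= h ts IH; congr tApp; apply/funext => i. Qed.

Lemma fren_id L (V : Type) (a : fo L V) : fren id a = a.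
Proof.
have omap_id (W : Type) : omap (@id W) = id by apply/funext; case.
elim: a => //= {V}.
- by move=> V s t; rewrite !tren_id.
- by move=> V r ts; congr fRel; apply/funext => i; rewrite tren_id.
- by move=> V b -> c ->.
- by move=> V b IHb; rewrite omap_id IHb.
Qed.

Lemma teval_tren L (S : structure L) (V W : Type) (f : V -> W) (t : term L V)
    (e : W -> S) :
  teval e (tren f t) = teval (e \o f) t.
Proof. by elim: t => //= h ts IH; congr fint; apply/funext. Qed.

Lemma scons_omap (S V W : Type) (f : V -> W) (x : S) (e : W -> S) :
  scons x e \o omap f = scons x (e \o f).
Proof. by apply/funext; case. Qed.

Lemma sat_fren L (S : structure L) (D : set S) (V W : Type) (f : V -> W)
    (a : fo L V) (e : W -> S) :
  sat D (fren f a) e <-> sat D a (e \o f).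
Proof.
elim: a W f e => //= {V}.
- by move=> V s t W f e; rewrite !teval_tren.
- move=> V r ts W f e.
  have -> : (fun i => teval e (tren f (ts i))) = (fun i => teval (e \o f) (ts i)).
    by apply/funext => i; rewrite teval_tren.
  by [].
- by move=> V b IHb c IHc W f e; split=> h /IHb /h /IHc.
- move=> V b IHb W f e.
  by split=> h x Dx; have := h x Dx; rewrite IHb scons_omap.
Qed.

Lemma holds_fren L (S : structure L) (V W : Type) (f : V -> W)
    (a : fo L V) (e : W -> S) :
  holds (fren f a) e <-> holds a (e \o f).
Proof. exact: sat_fren. Qed.

Lemma holds_auto L (S : structure L) (s : auto S) (V : Type)
    (a : fo L V) (e : V -> S) :
  holds a (s \o e) <-> holds a e.
Proof.
have tE (W : Type) (t : term L W) (e' : W -> S) :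
    teval (s \o e') t = s (teval e' t).
  elim: t => //= h ts IH; rewrite auto_fint; congr fint.
  by apply/funext => i /=; rewrite IH.
rewrite /holds; elim: a e => //= {V}.
- move=> V t u e; rewrite !tE; split=> [/(can_inj (afunK s))//|-> //].
- move=> V r ts e.
  have -> : (fun i => teval (s \o e) (ts i)) = s \o (fun i => teval e (ts i)).
    by apply/funext => i /=; rewrite tE.
  exact: iff_sym (auto_rint s _).
- by move=> V b IHb c IHc e; rewrite IHb IHc.
- move=> V b IHb e.
  have sE x : scons (s x) (s \o e) = s \o scons x e by apply/funext; case.
  split=> h x _; first by rewrite -IHb -sE; exact: h.
  by rewrite -(ainvK s x) sE IHb; exact: h.
Qed.

Lemma tren_support L (V : Type) (t : term L V) : exists s : seq {classic V},
  forall W (f g : V -> W), {in s, f =1 g} -> tren f t = tren g t.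
Proof.
elim: t => [v|h ts IH].
  by exists [:: v] => W f g fg /=; rewrite fg // mem_head.
have [s hs] := choice IH.
exists (flatten [seq s i | i : 'I_(farity h)]) => W f g fg /=; congr tApp.
apply/funext => i; apply: hs => x xs; apply: fg; apply/flattenP.
by exists (s i) => //; apply/mapP; exists i => //; rewrite mem_enum.
Qed.

Lemma fren_support L (V : Type) (a : fo L V) : exists s : seq {classic V},
  forall W (f g : V -> W), {in s, f =1 g} -> fren f a = fren g a.
Proof.
elim: a => {V} [V t u|V r ts|V|V b [s hs] c [s' hs']|V b [s hs]].
- have [[s hs] [s' hs']] := (tren_support t, tren_support u).
  exists (s ++ s') => W f g fg /=; congr fEq; [apply: hs|apply: hs'] => x xs;
    by apply: fg; rewrite mem_cat xs ?orbT.
- have [s hs] := choice (fun i => tren_support (ts i)).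
  exists (flatten [seq s i | i : 'I_(rarity r)]) => W f g fg /=; congr fRel.
  apply/funext => i; apply: hs => x xs; apply: fg; apply/flattenP.
  by exists (s i) => //; apply/mapP; exists i => //; rewrite mem_enum.
- by exists [::].
- exists (s ++ s') => W f g fg /=; congr fImp; [apply: hs|apply: hs'] => x xs;
    by apply: fg; rewrite mem_cat xs ?orbT.
(* The bound variable [None] is dropped: lifted renamings agree on it anyway. *)
- exists (pmap (id : {classic option V} -> option {classic V}) s) => W f g fg /=.
  congr fForall; apply: hs => -[x xs|//]; rewrite /= fg // mem_pmap.
  by apply/mapP; exists (Some x).
Qed.

Lemma fren_support_fin L (V : Type) k (a : 'I_k -> fo L V) :
  exists s : seq {classic V}, forall i,
    forall W (f g : V -> W), {in s, f =1 g} -> fren f (a i) = fren g (a i).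
Proof.
have [s hs] := choice (fun i => fren_support (a i)).
exists (flatten [seq s i | i : 'I_k]) => i W f g fg; apply: hs => x xs.
apply: fg; apply/flattenP.
by exists (s i) => //; apply/mapP; exists i => //; rewrite mem_enum.
Qed.

Lemma fo_support L (V : Type) k (a : 'I_k -> fo L V) :
  exists n (b : 'I_n -> V) (a0 : 'I_k -> fo L 'I_n),
    forall i, a i = fren b (a0 i).
Proof.
(* [nth] needs a default, so an empty variable type is treated apart. *)
have [[v0 _]|nV] := pselect (exists v : V, True); last first.
  have f (v : V) : 'I_0 by case: nV; exists v.
  have b (i : 'I_0) : V by case: i.
  exists 0%N, b, (fun i => fren f (a i)) => i; rewrite fren_comp -[LHS]fren_id.
  by congr fren; apply/funext => v; case: nV; exists v.
have [s hs] := fren_support_fin a.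
(* Variables outside [s] have index [size s]; the successor covers this index and makes the ordinal
   type inhabited for [inord]. *)
pose f (v : V) : 'I_(size s).+1 := inord (index (v : {classic V}) s).
exists (size s).+1, (fun i => nth v0 s i), (fun i => fren f (a i)) => i.
rewrite fren_comp -[LHS]fren_id; apply: hs => v vs /=; rewrite /f.
rewrite inordK; last by rewrite ltnS ltnW// index_mem.
exact/esym/(@nth_index {classic V}).
Qed.

(** Only parameters are abstracted: a position holding an object variable is renamed back to it, so
    the junk value [point] stored there is never read. *)
Lemma parmap_support L (X : Type) (P : pointedType) k (a : 'I_k -> fo L (X + P)) :
  exists n (b : 'I_n -> P) (a0 : 'I_k -> fo L (X + 'I_n)),
    forall i, a i = parmap b (a0 i).
Proof.
have [n [b [a0 ab]]] := fo_support a.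
exists n, (fun i => if b i is inr c then c else point),
  (fun i => fren (fun j => if b j is inl x then inl x else inr j) (a0 i)) => i.
rewrite ab /parmap fren_comp; congr fren; apply/funext => j /=.
by case bj: (b j) => [x|c] //=; rewrite bj.
Qed.

Lemma parmap_comp L (X P Q U : Type) (g : Q -> U) (f : P -> Q) (a : fo L (X + P)) :
  parmap g (parmap f a) = parmap (g \o f) a.
Proof.
by rewrite /parmap fren_comp; congr fren; apply/funext; case.
Qed.

Lemma parmap_id L (X P : Type) (a : fo L (X + P)) : parmap id a = a.
Proof.
by rewrite /parmap -[RHS]fren_id; congr fren; apply/funext; case.
Qed.

Lemma holds_parmap L (S : structure L) (X P Q : Type) (f : P -> Q)
    (a : fo L (X + P)) (b : X -> S) (par : Q -> S) :
  holds (parmap f a) (env b par) <-> holds a (env b (par \o f)).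
Proof.
rewrite /parmap holds_fren (_ : _ \o _ = env b (par \o f)) //.
by apply/funext; case.
Qed.

Lemma comp_env (S S' X P : Type) (f : S -> S') (b : X -> S) (par : P -> S) :
  f \o env b par = env (f \o b) (f \o par).
Proof. by apply/funext; case. Qed.

Lemma holds_and L (S : structure L) (V : Type) (a b : fo L V) (e : V -> S) :
  holds (fAnd a b) e <-> holds a e /\ holds b e.
Proof.
split; last by move=> [ha hb] h; exact: (h ha).
by move=> h; split; apply: contrapT => n; apply: h => // ha hb; exact: n.
Qed.

Definition fAnds L (V : Type) n (s : 'I_n -> fo L V) : fo L V :=
  foldr (@fAnd L V) fTrue [seq s i | i : 'I_n].

Lemma holds_ands L (S : structure L) (V : Type) n (s : 'I_n -> fo L V)
    (e : V -> S) :
  holds (fAnds s) e <-> forall i, holds (s i) e.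
Proof.
suff H (l : seq 'I_n) :
    holds (foldr (@fAnd L V) fTrue [seq s i | i <- l]) e <->
    forall i, i \in l -> holds (s i) e.
  rewrite /fAnds H; split=> h i => [|_]; last exact: h.
  by apply: h; rewrite mem_enum.
elim: l => [|j l IH] /=; first by split=> [_ i|_ []].
rewrite holds_and IH; split=> [[hj hl] i|h].
  by rewrite inE => /orP[/eqP->|/hl].
by split=> [|i il]; apply: h; rewrite inE ?eqxx ?il ?orbT.
Qed.

(** * Cardinals *)

Lemma card_le_injP (A B : Type) :
  [set: A] #<= [set: B] <-> exists f : A -> B, injective f.
Proof.
split=> [/card_leP[f]|[f fI]].
  exists (fun x => val (f (SigSub (mem_set (I : [set: A] x))))) => x y /val_inj.
  move=> /(inj (mem_set I) (mem_set I)) h.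
  by have := congr1 val h.
have [g] : $|{injfun [set: A] >-> [set: B]}|.
  by apply/injfunPex; exists f => // x y _ _ /fI.
exact: inj_card_le g.
Qed.

Lemma total_on_pair T (F : set (set T)) (x y : T) : total_on F subset ->
  (\bigcup_(X in F) X) x -> (\bigcup_(X in F) X) y ->
  exists X, [/\ F X, X x & X y].
Proof.
move=> tF [X FX Xx] [Y FY Yy]; case: (tF X Y FX FY) => [XY|YX].
- by exists Y; split => //; exact: XY.
- by exists X; split => //; exact: YX.
Qed.

(** Zorn's lemma for graphs of partial injections: if a maximal one misses [x] on the left and [y]
    on the right, the pair [(x, y)] can be added. *)
Lemma card_le_total (A B : Type) : [set: A] #<= [set: B] \/ [set: B] #<= [set: A].
Proof.
pose P (G : set (A * B)) := forall u v, G u -> G v -> u.1 = v.1 <-> u.2 = v.2.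
have [F FP tF|G [PG maxG]] := @Zorn_bigcup _ P.
  move=> u v Fu Fv; have [X [FX Xu Xv]] := total_on_pair tF Fu Fv.
  exact: (FP X).
have [/choice[f fG]|nA] := pselect (forall x, exists y, G (x, y)).
  left; apply/card_le_injP; exists f => x y fxy.
  exact/(PG _ _ (fG x) (fG y)).
have [/choice[f fG]|nB] := pselect (forall y, exists x, G (x, y)).
  right; apply/card_le_injP; exists f => x y fxy.
  exact/(PG _ _ (fG x) (fG y)).
move: nA nB => /existsNP[x nx] /existsNP[y ny].
exfalso; apply: (maxG (G `|` [set (x, y)])).
  split=> [u|/(_ (x, y))]; first by left.
  by move=> /(_ (or_intror erefl)) Gxy; apply: nx; exists y.
move=> [u1 u2] [v1 v2] /= [Gu|[-> ->]] [Gv|[-> ->]].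
- exact: (PG _ _ Gu Gv).
- split=> e; [case: nx; exists u2|case: ny; exists u1]; by rewrite -e.
- split=> e; [case: nx; exists v2|case: ny; exists v1]; by rewrite e.
- by split.
Qed.

(* By Zorn, an infinite type is, up to a finite remainder, partitioned into
   ranges of injective sequences. *)
Lemma card_le_double (A : Type) : infinite_set [set: A] ->
  [set: A + A] #<= [set: A].
Proof.
move=> Ainf.
(* One condition says both that the sequences are injective and that distinct ones have disjoint
   ranges. *)
pose P (F : set (nat -> A)) :=
  forall h h' n n', F h -> F h' -> h n = h' n' -> h = h' /\ n = n'.
have [F FP tF|F [PF maxF]] := @Zorn_bigcup _ P.
  move=> h h' n n' Fh Fh' e; have [X [FX Xu Xv]] := total_on_pair tF Fh Fh'.
  exact: (FP X FX).
pose R := [set t | forall h n, F h -> h n <> t].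
have Rfin : finite_set R.
  apply: contrapT => /infiniteP Rinf.
  have /card_leP[f] := Rinf.
  pose g n := val (f (SigSub (mem_set (I : [set: nat] n)))).
  have gR n : R (g n) by apply: set_mem; exact: valP.
  have gI : injective g.
    move=> x y /val_inj /(inj (mem_set I) (mem_set I)) h.
    by have := congr1 val h.
  apply: (maxF (F `|` [set g])).
    split=> [u|/(_ g)]; first by left.
    by move=> /(_ (or_intror erefl)) Fg; exact: (gR 0%N g 0%N).
  move=> h h' n n' [Fh|->] [Fh'|->] e.
  - exact: PF.
  - by case: (gR n' h n Fh).
  - by case: (gR n h' n' Fh').
  - by split=> //; exact: gI.
have [h0 Fh0] : exists h0, F h0.
  apply: contrapT => nF; apply: Ainf; apply: sub_finite_set Rfin => t _ h n Fh.
  by case: nF; exists h.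
have [r rI] : exists r : A -> nat, {in R &, injective r}.
  exact/pcard_injP/finite_set_countable.
(* A point in the range of [h] gets an even index in [h], a point of the finite remainder an odd
   index in [h0]. Doubling the index once more makes room for two copies of [A]. *)
pose code_spec t (c : (nat -> A) * nat) := F c.1 /\
  ((exists n, c.2 = n.*2 /\ t = c.1 n) \/ [/\ R t, c.1 = h0 & c.2 = (r t).*2.+1]).
have /choice[code codeP] t : exists c, code_spec t c.
  have [Rt|/existsNP[h /existsNP[n]]] := pselect (R t).
    by exists (h0, (r t).*2.+1); split => //; right.
  move=> /not_implyP[Fh /contrapT <-]; exists (h, n.*2); split => //.
  by left; exists n.
have codeI : injective code.
  move=> s t e; have := codeP s; have := codeP t; rewrite -{}e.
  move: (code s) => [h k] [/= Fh H] [_ /= H'].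
  case: H H' => [[n [-> ->]]|[Rt -> ->]] [[m []]|[Rs]] //.
  - by move=> /double_inj-> ->.
  - by move=> _ /(congr1 odd); rewrite /= !odd_double.
  - by move=> /(congr1 odd); rewrite /= !odd_double.
  - by move=> _ [] /double_inj /rI -> //; rewrite inE.
apply/card_le_injP.
exists (fun v : A + A => match v with
  | inl t => (code t).1 (code t).2.*2
  | inr t => (code t).1 (code t).2.*2.+1 end).
have pairE (u v : (nat -> A) * nat) : u.1 = v.1 -> u.2 = v.2 -> u = v.
  by case: u v => [? ?] [? ?] /= -> ->.
have F1 t : F (code t).1 by case: (codeP t).
move=> [s|s] [t|t] /PF[] // e1.
- by move=> /double_inj e2; congr inl; apply: codeI; exact: pairE.
- by move=> /(congr1 odd); rewrite /= !odd_double.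
- by move=> /(congr1 odd); rewrite /= !odd_double.
- by move=> [] /double_inj e2; congr inr; apply: codeI; exact: pairE.
Qed.

Lemma card_le_lt (A B K : Type) : [set: A] #<= [set: B] -> card_lt B K ->
  card_lt A K.
Proof.
move=> AB [BK KB]; split; first exact: card_le_trans BK.
by move=> KA; apply: KB; exact: card_le_trans AB.
Qed.

Lemma card_lt_le (A B K : Type) : card_lt A B -> [set: B] #<= [set: K] ->
  card_lt A K.
Proof.
move=> [AB BA] BK; split; first exact: card_le_trans BK.
by move=> KA; apply: BA; exact: card_le_trans KA.
Qed.

Lemma card_lt_fin (A K : Type) : infinite_set [set: K] ->
  finite_set [set: A] -> card_lt A K.
Proof.
move=> /[dup] Kinf /infiniteP NK Afin; split.
  exact: card_le_trans (finite_set_countable Afin) NK.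
by move=> /card_le_finite /(_ Afin).
Qed.

(** With [B] the larger summand, the sum is finite if [B] is, and otherwise embeds into [B + B],
    hence into [B]. *)
Lemma card_lt_sum (A B K : Type) : infinite_set [set: K] ->
  card_lt A K -> card_lt B K -> card_lt (A + B) K.
Proof.
wlog AB : A B / [set: A] #<= [set: B].
  move=> H Kinf AK BK; case: (card_le_total A B) => AB; first exact: H.
  apply: card_le_lt (H B A AB Kinf BK AK); apply/card_le_injP.
  by exists (fun v => match v with inl a => inr a | inr b => inl b end)
    => -[]x []y // [->].
move=> Kinf AK BK; have /card_le_injP[f fI] := AB.
have [Bfin|Binf] := pselect (finite_set [set: B]).
  apply: card_lt_fin => //.
  have -> : [set: A + B] = (inl @` setT) `|` (inr @` setT).
    by apply/seteqP; split=> // -[a|b] _; [left; exists a|right; exists b].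
  rewrite finite_setU; split; apply: finite_image => //.
  exact: card_le_finite Bfin.
apply: card_le_lt BK; apply: card_le_trans (card_le_double Binf).
apply/card_le_injP.
exists (fun v => match v with inl a => inl (f a) | inr b => inr b end).
by move=> [x|x] [y|y] // [] => [/fI|] ->.
Qed.

Lemma monster_infinite L (S : structure L) (K : Type) : monster K S ->
  infinite_set [set: K].
Proof.
move=> [[LK _] _ _]; apply/infiniteP; apply: card_le_trans LK.
by apply/card_le_injP; exists (fun n => fEq (tVar L n) (tVar L n)) => m n [].
Qed.

(** * Realizing types *)

(** Strong homogeneity speaks of subsets, whereas [u] may repeat entries. One index is chosen per
    value of [u]; equality formulas show that [v] repeats where [u] does. *)
Lemma homogeneous_auto K L (S : structure L) (V : Type) (u v : V -> S) :
  strongly_homogeneous K S -> card_lt V K ->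
  (forall a : fo L V, holds a u <-> holds a v) ->
  exists s : auto S, forall x, s (u x) = v x.
Proof.
move=> hom VK uv.
have /choice[f fE] (a : range u) : exists x, u x = val a.
  by have [x _ xa] : range u (val a) := set_mem (valP a); exists x.
have [||s sE] := hom (range u) _ (v \o f).
- apply: card_le_lt VK; apply/card_le_injP; exists f => a b fab.
  by apply: val_inj; rewrite -!fE fab.
- move=> a; rewrite -(holds_fren f a v) -uv holds_fren.
  by rewrite (_ : u \o f = set_val) //; apply/funext => b; rewrite /= fE.
exists s => x; have xr : u x \in range u by rewrite inE; exists x.
rewrite (sE (SigSub xr)) /=; set y := f _.
have /uv : holds (fEq (tVar L y) (tVar L x)) u by rewrite /holds /= /y fE.
by [].
Qed.

Section Realize.
Context {K : Type} {L : language} {S S' : structure L} {V : Type}.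
Variable q : fo L V -> Prop.
Hypothesis qc : forall a, q a \/ q (fNot a).
Hypothesis qs : forall n (s : 'I_n -> fo L V), (forall i, q (s i)) ->
  exists b : V -> S', forall i, holds (s i) b.

(** Otherwise [q] contains [fNot a], which together with the family [s] has no solution. *)
Lemma complete_entails n (s : 'I_n -> fo L V) a : (forall i, q (s i)) ->
  (forall b : V -> S', (forall i, holds (s i) b) -> holds a b) -> q a.
Proof.
move=> qsi sa; have [//|qna] := qc a.
have [|b hb] := qs (s := fun i : 'I_n.+1 =>
    if unlift ord0 i is Some j then s j else fNot a).
  by move=> i; case: unliftP.
have := hb ord0; rewrite unlift_none => na; exfalso; apply: na; apply: sa => i.
by have := hb (lift ord0 i); rewrite liftK.
Qed.

Lemma complete_refl t : q (fEq t t).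
Proof. by apply: (@complete_entails 0 (fun=> fFalse)) => [[]|]. Qed.

(** [G] is a relation, but equality formulas make its values unique. One implication suffices, since
    completeness of [q] yields the converse. *)
Definition partial_realization (G : set (V * S)) :=
  forall n (a : fo L 'I_n) (z : 'I_n -> V * S), (forall i, G (z i)) ->
    q (fren (fst \o z) a) -> holds a (snd \o z).

Lemma partial_realizationP (G : set (V * S)) : partial_realization G ->
  forall n (a : fo L 'I_n) (z : 'I_n -> V * S) (Gz : forall i, G (z i)),
    q (fren (fst \o z) a) <-> holds a (snd \o z).
Proof.
move=> rG n a z Gz; split=> [|ha]; first exact: rG.
by have [//|/(rG _ (fNot a) z Gz)/(_ ha)] := qc (fren (fst \o z) a).
Qed.

Lemma partial_realization_eq (G : set (V * S)) u v : partial_realization G ->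
  G u -> G v -> q (fEq (tVar L u.1) (tVar L v.1)) <-> u.2 = v.2.
Proof.
move=> rG Gu Gv.
pose z (i : 'I_2) := if val i == 0%N then u else v.
have Gz i : G (z i) by rewrite /z; case: ifP.
exact: (partial_realizationP rG (fEq (tVar L ord0) (tVar L ord_max)) Gz).
Qed.

Lemma total_on_ord T (F : set (set T)) n (z : 'I_n.+1 -> T) :
  total_on F subset -> (forall i, (\bigcup_(X in F) X) (z i)) ->
  exists2 X, F X & forall i, X (z i).
Proof.
move=> tF; elim: n z => [|n IH] z hz.
  by have [X FX Xz] := hz ord0; exists X => // i; rewrite (ord1 i).
have [|X FX Xz] := IH (z \o lift ord0); first by move=> i; exact: hz.
have [Y FY Yz] := hz ord0.
case: (tF X Y FX FY) => [XY|YX]; [exists Y|exists X] => // i;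
  case: (unliftP ord0 i) => [j|] -> //.
- exact/XY/Xz.
- exact: Xz.
- exact/YX.
Qed.

(** A maximal partial realization extending [G0] is total: for a variable [v] without value, the
    formulas of [q] about [v] and the assigned values form a complete type over a set no larger than
    [V], which saturation realizes. *)
Lemma realize_partial (G0 : set (V * S)) : saturated K S -> card_lt V K ->
  partial_realization G0 ->
  exists b : V -> S, (forall a, q a <-> holds a b) /\
    (forall u, G0 u -> b u.1 = u.2).
Proof.
move=> satS VK rG0.
have [F FP tF|G [rG maxG]] :=
    @Zorn_bigcup _ [set G | partial_realization (G `|` G0)].
  have [F0|/set0P[X0 FX0]] := eqVneq F set0.
    by rewrite F0 /= bigcup_set0 set0U.
  case=> [|n] a z Gz; first by apply: rG0 => -[].
  have [|i|_ [X FX <-] Xz] := @total_on_ord _ [set X `|` G0 | X in F] n z.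
  - move=> _ _ [X FX <-] [Y FY <-].
    by case: (tF X Y FX FY) => h; [left|right]; exact: setSU.
  - case: (Gz i) => [[X FX Xz]|G0z].
      by exists (X `|` G0); [exists X|left].
    by exists (X0 `|` G0); [exists X0|right].
  - exact: (FP X FX).
set Gx := G `|` G0 in rG.
have Gtot v : exists x, Gx (v, x).
  apply: contrapT => nv.
  pose A : set S := [set x | exists u, Gx (u, x)].
  have /choice[pre preP] (a : A) : exists u, Gx (u, val a).
    exact: (set_mem (valP a)).
  pose rho (o : unit + A) := match o with inl _ => v | inr a => pre a end.
  have r_type : is_type set_val [set a : fo L (unit + A) | q (fren rho a)].
    split=> [n s rs|a]; last exact: qc.
    pose kap (o : unit + A) := match o with inl _ => None | inr a => Some a end.
    (* Finite satisfiability: [q] contains the statement that some value of [v] satisfies all [s i].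
       It mentions only assigned variables, so it is true of their values. *)
    pose ex := fNot (fForall (fNot (fren kap (fAnds s)))).
    have exP (T : structure L) (e : A -> T) : holds ex e <->
        exists x, forall i, holds (s i) (env (fun=> x) e).
      have sE x : scons x e \o kap = env (fun=> x) e by apply/funext; case.
      split=> [h|[x hx] h].
        apply: contrapT => nx; apply: h => x _ hx; apply: nx; exists x.
        have : holds (fren kap (fAnds s)) (scons x e) := hx.
        by rewrite holds_fren sE holds_ands.
      apply: (h x I); suff: holds (fren kap (fAnds s)) (scons x e) by [].
      by rewrite holds_fren sE holds_ands.
    have qex : q (fren pre ex).
      apply: (complete_entails rs) => b hb; rewrite holds_fren exP.
      exists (b v) => i; have := hb i; rewrite holds_fren.
      by rewrite (_ : b \o rho = env (fun=> b v) (b \o pre))//; apply/funext; case.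
    have [m [b [a0 /(_ ord0) exE]]] := fo_support (fun _ : 'I_1 => ex).
    have : holds ex (@set_val S A).
      rewrite exE holds_fren.
      apply: (rG m (a0 ord0) (fun i => (pre (b i), val (b i)))) => [i|].
        exact: preP.
      by rewrite -[_ \o _]/(pre \o b) -fren_comp -exE.
    by rewrite exP => -[x hx]; exists (fun=> x).
  have AK : card_lt A K.
    apply: card_le_lt VK; apply/card_le_injP; exists pre => a b ab.
    apply: val_inj; apply/(partial_realization_eq rG (preP a) (preP b)).
    by rewrite ab; exact: complete_refl.
  have [c cr] := satS A AK (SType r_type).
  apply: (maxG (G `|` [set (v, c tt)])).
    split=> [u|/(_ (v, c tt))]; first by left.
    by move=> /(_ (or_intror erefl)) Gv; apply: nv; exists (c tt); left.
  move=> n a z zG.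
  have zP i : Gx (z i) \/ z i = (v, c tt).
    by case: (zG i) => [[Gz|]|G0z]; [left; left|right|left; right].
  have /choice[kap kapP] (i : 'I_n) : exists o : unit + A,
      match o with inl _ => z i = (v, c tt)
                 | inr x => Gx (z i) /\ (z i).2 = val x end.
    case: (zP i) => [Gz|zv]; last by exists (inl tt).
    have zA : A (z i).2 by exists (z i).1; rewrite -surjective_pairing.
    by exists (inr (SigSub (mem_set zA))).
  move=> qa.
  have : q (fren rho (fren kap a)).
    rewrite fren_comp.
    pose s (i : 'I_n.+1) := if unlift ord0 i is Some j then
      fEq (tVar L (rho (kap j))) (tVar L (z j).1) else fren (fst \o z) a.
    apply: (@complete_entails _ s) => [i|b hb].
      rewrite /s; case: unliftP => [j _|//].
      have := kapP j; case: (kap j) => [_ ->|x [Gz zx]] /=.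
        exact: complete_refl.
      by apply/(partial_realization_eq rG (preP x) Gz); rewrite zx.
    have := hb ord0; rewrite /s unlift_none !holds_fren.
    rewrite (_ : b \o (fst \o z) = b \o (rho \o kap)) //; apply/funext => j /=.
    by have := hb (lift ord0 j); rewrite /s liftK.
  move=> /(cr (fren kap a)); rewrite holds_fren.
  rewrite (_ : env c set_val \o kap = snd \o z) //; apply/funext => i /=.
  by have := kapP i; case: (kap i) => [[] ->|x [_ ->]].
have /choice[b bG] := Gtot; exists b; split=> [a|u G0u].
  have [n [f [a0 /(_ ord0) aE]]] := fo_support (fun _ : 'I_1 => a).
  rewrite aE holds_fren.
  exact: (partial_realizationP rG (a0 ord0) (fun i => bG (f i))).
have Gu : Gx u by right.
apply/(partial_realization_eq rG (bG u.1) Gu); exact: complete_refl.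
Qed.
End Realize.

(** * Invariant extensions and the products *)

(** The parameters are pinned by starting from the graph of [par], which the last hypothesis makes a
    partial realization. *)
Lemma realize_type K L (S S' : structure L) (W P : Type) (par : P -> S)
    (q : fo L (W + P) -> Prop) :
  saturated K S -> card_lt (W + P) K ->
  (forall a, q a \/ q (fNot a)) ->
  (forall n (s : 'I_n -> fo L (W + P)), (forall i, q (s i)) ->
    exists b : W + P -> S', forall i, holds (s i) b) ->
  (forall a : fo L P, q (fren inr a) -> holds a par) ->
  exists b : W -> S, realizes par b q.
Proof.
move=> satS WPK qc qs qpar.
have [|b [qb bpar]] := @realize_partial K L S S' _ q qc qs
    [set u | exists c, u = (inr c, par c)] satS WPK.
  move=> n a z /choice[f zf] qa.
  have zE : z = (fun i => (inr (f i), par (f i))) by exact/funext.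
  move: qa; rewrite zE -[fst \o _]/(inr \o f) -fren_comp => /qpar.
  by rewrite holds_fren.
exists (b \o inl) => a; rewrite qb.
rewrite (_ : env (b \o inl) par = b) //; apply/funext => -[//|c] /=.
by rewrite (bpar (inr c, par c)) //; exists c.
Qed.

Section AutoGroup.
Context {L : language} {S : structure L}.
Implicit Types s t : auto S.

Definition auto_inv s : auto S.
Proof.
refine (@Auto L S (ainv s) s (ainvK s) (afunK s) _ _) => f a.
- apply: (can_inj (afunK s)); rewrite ainvK auto_fint; congr fint.
  by apply/funext => i /=; rewrite ainvK.
- rewrite [in X in _ <-> X](auto_rint s).
  have -> : s \o (ainv s \o a) = a by apply/funext => i /=; rewrite ainvK.
  by [].
Defined.

Definition auto_comp s t : auto S.
Proof.
refine (@Auto L S (s \o t) (ainv t \o ainv s) _ _ _ _).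
- by move=> x /=; rewrite !afunK.
- by move=> x /=; rewrite !ainvK.
- by move=> f a /=; rewrite !auto_fint.
- by move=> r a; rewrite (auto_rint t) (auto_rint s).
Defined.

Lemma fixes_inv (A : set S) s : fixes A s -> fixes A (auto_inv s).
Proof. by move=> fs a /fs sa; rewrite /= -[in LHS]sa afunK. Qed.

Lemma fixes_comp (A : set S) s t :
  fixes A s -> fixes A t -> fixes A (auto_comp s t).
Proof. by move=> fs ft a Aa; rewrite /= ft // fs. Qed.

End AutoGroup.

Lemma parmap_inj L (X : Type) (P : pointedType) (Q : Type) (f : P -> Q) :
  injective f -> injective (@parmap L X P Q f).
Proof.
move=> fI; pose h y := xget point [set x | f x = y].
have hK : h \o f = id.
  apply/funext => x /=; apply: fI.
  by rewrite (xgetPex point (P := [set x' | f x' = f x])) //; exists x.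
move=> a b /(congr1 (parmap h)).
by rewrite !parmap_comp hK !parmap_id.
Qed.

(** * Conjugating tuples and formulas of the larger model into the smaller one *)

Section Conjugation.
Context {K K' : Type} {L : language} {C C' : structure L} {iota : C -> C'}.
Variable M : set C.
Hypotheses (hmon : monster K C) (hmon' : monster K' C').
Hypothesis hiota : elementary_embedding iota.
Hypothesis hKK' : [set: K] #<= [set: K'].
Hypothesis MK : card_lt M K.

Lemma iota_inj : injective iota.
Proof.
move=> x y xy.
have := hiota (fEq (tVar L true) (tVar L false)) (fun b : bool => if b then x else y).
by rewrite /holds /= => ->.
Qed.

Lemma card_lt_ord n : card_lt 'I_n K.
Proof. by apply: card_lt_fin; [exact: monster_infinite hmon|exact: finite_finset]. Qed.

Lemma descend (W P : Type) (par : P -> C) (d : W -> C') : card_lt (W + P) K ->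
  exists d' : W -> C, forall a : fo L (W + P),
    holds a (env d' par) <-> holds a (env d (iota \o par)).
Proof.
move=> WPK; have [_ satC _] := hmon.
have [||a|d' dE] := @realize_type K L C C' W P par
  (fun a => holds a (env d (iota \o par))) satC WPK.
- by move=> a; exact: EM.
- by move=> n s hs; exists (env d (iota \o par)).
- by rewrite holds_fren => /(hiota a par).
by exists d' => a; rewrite dE.
Qed.

(** Saturation of [C] finds a tuple there with the type of [d] over [M]; homogeneity of [C'] then
    provides [s]. This reduces questions over [C'] to questions over [C]. *)
Lemma conj_tuple (W : Type) (d : W -> C') : card_lt W K ->
  exists (d' : W -> C) (s : auto C'),
    fixes (iota @` M) s /\ forall w, s (iota (d' w)) = d w.
Proof.
move=> WK; have WMK : card_lt (W + M) K.
  by apply: card_lt_sum => //; exact: monster_infinite hmon.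
have [d' dE] := descend (@set_val C M) d WMK.
have [_ _ homC'] := hmon'.
have [|a|s sE] := @homogeneous_auto K' L C' (W + M)
    (iota \o env d' set_val) (env d (iota \o set_val)) homC'.
- exact: card_lt_le hKK'.
- by rewrite -dE; exact: iff_sym (hiota _ _).
exists d', s; split=> [_ [m Mm <-]|w]; last exact: (sE (inl w)).
exact: (sE (inr (SigSub (mem_set Mm)))).
Qed.

Lemma same_type_conj (W : Type) (d1 d2 : W -> C) : card_lt W K ->
  (forall a : fo L (W + M),
    holds a (env d1 set_val) <-> holds a (env d2 set_val)) ->
  exists s : auto C, fixes M s /\ s \o d1 = d2.
Proof.
move=> WK d12; have WMK : card_lt (W + M) K.
  by apply: card_lt_sum => //; exact: monster_infinite hmon.
have [_ _ homC] := hmon; have [s sE] := homogeneous_auto homC WMK d12.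
exists s; split=> [m Mm|]; last by apply/funext => w; exact: (sE (inl w)).
exact: (sE (inr (SigSub (mem_set Mm)))).
Qed.

Lemma conj_tuple_down (W : Type) (d1 d2 : W -> C) (r : auto C') :
  card_lt W K -> fixes (iota @` M) r ->
  (forall w, r (iota (d1 w)) = iota (d2 w)) ->
  exists s : auto C, fixes M s /\ s \o d1 = d2.
Proof.
move=> WK fr rE; apply: same_type_conj => // a.
rewrite (hiota a (env d1 _)) (hiota a (env d2 _)) -(holds_auto r).
rewrite (_ : r \o _ = iota \o env d2 set_val) //.
apply/funext => -[w|m] /=; first exact: rE.
by apply: fr; exists (val m) => //; exact: set_mem (valP m).
Qed.

Lemma holds_conj (X : Type) (s : auto C') (a : fo L (X + C)) (b : X -> C) :
  holds (parmap (s \o iota) a) (env (s \o iota \o b) id) <-> holds a (env b id).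
Proof.
rewrite holds_parmap -[id \o _]/(s \o iota \o id) -(comp_env _ b id).
by rewrite -[_ \o env _ _]/(s \o (iota \o env b id)) holds_auto (hiota a (env b id)).
Qed.

(** Finitely many formulas share a finite parameter tuple, so one automorphism conjugates them all,
    and conditions relating several formulas can be checked over [C]. *)
Lemma conj_formula (X : Type) k (a : 'I_k -> fo L (X + C')) :
  exists (s : auto C') (t : 'I_k -> fo L (X + C)),
    fixes (iota @` M) s /\ forall i, a i = parmap (s \o iota) (t i).
Proof.
have [n [c [a0 aE]]] := parmap_support a.
have [d [s [fs sE]]] := conj_tuple c (card_lt_ord n).
exists s, (fun i => parmap d (a0 i)); split=> // i.
by rewrite aE parmap_comp; congr parmap; apply/funext => j /=; rewrite sE.
Qed.

(** The images of [d] under [s1] and [s2] need not come from [C], so [r] pulls both into [C] at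
    once. There the two formulas coincide, and each half is conjugate to [d] by an automorphism of
    [C] over [M], under which [g] is invariant. *)
Lemma conj_formula_unique (X Y : Type) (g : fo L (X + C) -> Y)
    (s1 s2 : auto C') (t1 t2 : fo L (X + C)) :
  (forall s : auto C, fixes M s -> forall a, g (parmap s a) = g a) ->
  fixes (iota @` M) s1 -> fixes (iota @` M) s2 ->
  parmap (s1 \o iota) t1 = parmap (s2 \o iota) t2 -> g t1 = g t2.
Proof.
move=> gM fs1 fs2 t12.
have [n [d [b tE]]] :=
  parmap_support (fun i : 'I_2 => if val i == 0%N then t1 else t2).
have {}t1E : t1 = parmap d (b ord0) := tE ord0.
have {tE}t2E : t2 = parmap d (b ord_max) := tE ord_max.
pose e (v : 'I_n + 'I_n) := match v with
  inl i => s1 (iota (d i)) | inr i => s2 (iota (d i)) end.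
have [|e' [r [fr rE]]] := conj_tuple e.
  by apply: card_lt_sum; try exact: card_lt_ord; exact: monster_infinite hmon.
have eE : parmap (e' \o inl) (b ord0) = parmap (e' \o inr) (b ord_max).
  have rI : injective (r \o iota).
    exact: inj_comp (can_inj (afunK r)) iota_inj.
  apply: (parmap_inj rI); rewrite !parmap_comp.
  rewrite (_ : _ \o _ = s1 \o iota \o d); last first.
    by apply/funext => i /=; rewrite rE.
  rewrite [in RHS](_ : _ \o _ = s2 \o iota \o d); last first.
    by apply/funext => i /=; rewrite rE.
  by rewrite -!(parmap_comp _ d) -t1E -t2E.
have gE (s : auto C') (t : fo L (X + 'I_n)) (h : 'I_n -> C) :
    fixes (iota @` M) s -> (forall i, r (iota (h i)) = s (iota (d i))) ->
    g (parmap d t) = g (parmap h t).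
  move=> fs hs.
  have [|||s' [fs' sE]] := @conj_tuple_down 'I_n d h (auto_comp (auto_inv r) s).
  - exact: card_lt_ord.
  - by apply: fixes_comp => //; exact: fixes_inv.
  - by move=> i /=; rewrite -hs afunK.
  by rewrite -(gM s' fs') parmap_comp sE.
have g1 : g (parmap d (b ord0)) = g (parmap (e' \o inl) (b ord0)).
  by apply: (gE s1) => // i; rewrite /= rE.
have g2 : g (parmap d (b ord_max)) = g (parmap (e' \o inr) (b ord_max)).
  by apply: (gE s2) => // i; rewrite /= rE.
by rewrite t1E t2E g1 g2 eE.
Qed.

Lemma invariant_extension (X Y : Type) (g : fo L (X + C) -> Y) :
  (forall s : auto C, fixes M s -> forall a, g (parmap s a) = g a) ->
  exists g' : fo L (X + C') -> Y, forall (s : auto C') t,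
    fixes (iota @` M) s -> g' (parmap (s \o iota) t) = g t.
Proof.
move=> gM.
have /choice[f fP] (a : fo L (X + C')) : exists u : auto C' * fo L (X + C),
    fixes (iota @` M) u.1 /\ a = parmap (u.1 \o iota) u.2.
  have [s [t [fs aE]]] := conj_formula (fun _ : 'I_1 => a).
  by exists (s, t ord0); split=> //; exact: (aE ord0).
exists (fun a => g (f a).2) => s t fs.
have [fs' e] := fP (parmap (s \o iota) t).
exact: (conj_formula_unique gM fs' fs (esym e)).
Qed.

(** * Invariant extensions of types and measures, and their translates *)

Section Extensions.
Context {I : Type}.

(** The candidate [g'] is finitely satisfiable, because finitely many formulas in it are translates
    of formulas of [p] by one automorphism. Hence [xget] does not return its default, and invariance
    determines the value on every translate. *)
Lemma type_extP (p : gtype I C) (s : auto C') t : type_invariant M p ->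
  fixes (iota @` M) s -> type_ext iota M p (parmap (s \o iota) t) <-> p t.
Proof.
move=> pM fs; have [|g' g'E] := @invariant_extension I Prop p.
  by move=> s' fs' a; apply/propext; exact: pM.
have p'_type : is_type (@id C') g'.
  split=> [n a ha|a].
    have [s' [a' [fs' aE]]] := conj_formula a.
    have [fp _] := st_is_type p.
    have [|b hb] := fp n a'; first by move=> i; rewrite -(g'E s') // -aE.
    exists (s' \o iota \o b) => i.
    by rewrite aE holds_conj.
  have [s' [a' [fs' /(_ ord0) aE]]] := conj_formula (fun _ : 'I_1 => a).
  have [_ cp] := st_is_type p.
  rewrite aE -[fNot (parmap _ _)]/(parmap (s' \o iota) (fNot (a' ord0))).
  by rewrite !g'E.
have [eM eE] : type_invariant (iota @` M) (type_ext iota M p) /\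
    forall a, type_ext iota M p (parmap iota a) <-> p a.
  apply: (xgetPex point (P := [set p' : gtype I C' |
    type_invariant (iota @` M) p' /\ forall a, p' (parmap iota a) <-> p a])).
  exists (SType p'_type); split=> [s' fs' a|a] /=; last first.
    by rewrite -(g'E (auto_id C')).
  have [s1 [a' [fs1 /(_ ord0) ->]]] := conj_formula (fun _ : 'I_1 => a).
  rewrite parmap_comp -[s' \o _]/(auto_comp s' s1 \o iota) !g'E //.
  exact: fixes_comp.
by rewrite -parmap_comp eM.
Qed.

Context {R : realType}.

(** Each Keisler axiom involves at most two formulas, which [pair] moves to [C] by one
    automorphism. *)
Lemma measure_extP (mu : fo L (I + C) -> R) (s : auto C') t : keisler mu ->
  measure_invariant M mu ->
  fixes (iota @` M) s -> measure_ext iota M mu (parmap (s \o iota) t) = mu t.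
Proof.
move=> [mu0 mu1 muE muD] muM fs; have [g' g'E] := invariant_extension muM.
have pair (a b : fo L (I + C')) : exists (s' : auto C') a' b',
    [/\ fixes (iota @` M) s', a = parmap (s' \o iota) a' &
        b = parmap (s' \o iota) b'].
  have [s' [u [fs' uE]]] := conj_formula (fun i : 'I_2 => if val i == 0%N then a else b).
  exists s', (u ord0), (u ord_max).
  by split=> //; [exact: (uE ord0)|exact: (uE ord_max)].
have [_ eM eE] : [/\ keisler (measure_ext iota M mu),
    measure_invariant (iota @` M) (measure_ext iota M mu) &
    forall a, measure_ext iota M mu (parmap iota a) = mu a].
  apply: (xgetPex (fun=> 0%R) (P := [set mu' : fo L (I + C') -> R |
    [/\ keisler mu', measure_invariant (iota @` M) mu' &
    forall a, mu' (parmap iota a) = mu a]])).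
  exists g'; split; last by move=> a; rewrite -(g'E (auto_id C')).
    split.
    - by move=> a; have [s' [a' [_ [fs' -> _]]]] := pair a a; rewrite g'E.
    - move=> a; have [s' [a' [_ [fs' -> _]]]] := pair a a => h; rewrite g'E //.
      by apply: mu1 => b; rewrite -(holds_conj s'); exact: h.
    - move=> a b; have [s' [a' [b' [fs' -> ->]]]] := pair a b => h.
      rewrite !g'E //; apply: muE.
      by move=> e; rewrite -!(holds_conj s'); exact: h.
    - move=> a b; have [s' [a' [b' [fs' -> ->]]]] := pair a b => h.
      rewrite -[fOr _ _]/(parmap (s' \o iota) (fOr a' b')) !g'E //.
      apply: muD.
      move=> e; rewrite -(holds_conj s'); exact: h.
  move=> s' fs' a; have [s1 [a' [_ [fs1 -> _]]]] := pair a a.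
  rewrite parmap_comp -[s' \o _]/(auto_comp s' s1 \o iota) !g'E //.
  exact: fixes_comp.
by rewrite -parmap_comp eM.
Qed.

Variable nbar : I -> C.
Hypothesis IK : card_lt I K.
Hypothesis hCK' : card_lt C K'.

(** Saturation realizes [q] in [C'], where [C] is small. The realization has the same type over the
    empty set as [nbar], so homogeneity carries [nbar] to it. *)
Lemma realizerP (q : gtype I C) : S_nbar nbar q ->
  realizes iota (realizer iota nbar q \o iota \o nbar) q.
Proof.
move=> Sq; have [fq cq] := st_is_type q; have [_ satC' homC'] := hmon'.
have IK' : card_lt I K' by exact: card_lt_le hKK'.
have [||n s hs|a qa|b bq] := @realize_type K' L C' C I C iota q satC'.
- by apply: card_lt_sum => //; exact: monster_infinite hmon'.
- exact: cq.
- by have [b hb] := fq n s hs; exists (env b id).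
- have [//|b /(_ ord0)] := fq 1 (fun=> fren inr a).
  rewrite holds_fren => ha.
  exact/(hiota a id).
have [|s sE] := @homogeneous_auto K' L C' I (iota \o nbar) b homC' IK'.
  move=> a; rewrite -(hiota a nbar).
  suff H (a' : fo L I) : holds a' nbar -> holds a' b.
    by split=> [/H//|hb]; apply: contrapT => /(H (fNot a)) /(_ hb).
  by move=> /Sq /bq; rewrite holds_fren.
apply: (xgetPex (auto_id C') (P := [set t : auto C' |
  realizes iota (t \o iota \o nbar) q])).
by exists s => a; rewrite (_ : _ \o nbar = b)//; apply/funext.
Qed.

(** The translated type is finitely satisfiable in [C], so [xget] returns it: a solution in [C] is
    moved into [C'] by [s'] and [tau], then descended over the parameters. *)
Lemma tmulP (p q : gtype I C) a : type_invariant M p ->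
  tmul iota nbar M p q a <->
  type_ext iota M p (parmap (ainv (realizer iota nbar q)) (parmap iota a)).
Proof.
move=> pM; set tau := realizer _ _ _.
pose r (a : fo L (I + C)) : Prop :=
  type_ext iota M p (parmap (ainv tau) (parmap iota a)).
have r_type : is_type (@id C) r.
  split=> [n s rs|b]; last first.
    by have [_ cp] := st_is_type (type_ext iota M p); exact: cp.
  have [s' [t [fs' tE]]] :=
    conj_formula (fun i => parmap (ainv tau) (parmap iota (s i))).
  have [fp _] := st_is_type p.
  have [|b hb] := fp n t.
    by move=> i; rewrite -(type_extP (s := s')) // -tE; exact: rs.
  have [m [c [s0 s0E]]] := parmap_support s.
  have IOK : card_lt (I + 'I_m) K.
    by apply: card_lt_sum => //; [exact: monster_infinite hmon|exact: card_lt_ord].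
  have [d dE] := descend c (tau \o (s' \o iota \o b)) IOK.
  exists d => i; rewrite s0E holds_parmap dE.
  have := hb i; rewrite -(holds_conj s') -tE s0E !parmap_comp holds_parmap.
  rewrite -(holds_auto tau) comp_env.
  rewrite [X in env _ X](_ : _ = iota \o (id \o c)) //.
  by apply/funext => j; rewrite /= ainvK.
apply: (xgetPex point (P := [set r0 : gtype I C | forall a, r0 a <-> r a])).
by exists (SType r_type).
Qed.

Variable j : M -> I.
Hypothesis jE : forall m, nbar (j m) = val m.

(* The formula psi(y; x_M), with y now a tuple of parameters and the elements of
   [M] replaced by the corresponding variables. *)
Definition swap_vars n (psi : fo L ('I_n + M)) : fo L (I + 'I_n) :=
  fren (fun v => match v with inl i => inr i | inr m => inl (j m) end) psi.

(* Here [d] realizes in [C] the type over [M] of the preimage of [c] under the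
   automorphism attached to [q]. *)
Lemma mul_shift (q : gtype I C) n (c : 'I_n -> C) : S_nbar nbar q ->
  exists d : 'I_n -> C, [/\
    forall (mu : fo L (I + C) -> R) phi, keisler mu -> measure_invariant M mu ->
      mtmul iota nbar M mu q (parmap c phi) = mu (parmap d phi),
    forall p phi, type_invariant M p ->
      tmul iota nbar M p q (parmap c phi) <-> p (parmap d phi) &
    forall psi : fo L ('I_n + M),
      holds psi (env d set_val) <-> q (parmap c (swap_vars psi))].
Proof.
move=> Sq; set tau := realizer iota nbar q.
have [d [s [fs sE]]] := conj_tuple (ainv tau \o iota \o c) (card_lt_ord n).
have cd phi : parmap (ainv tau) (parmap iota (parmap c phi)) =
    parmap (s \o iota) (parmap d phi) :> fo L (I + C').
  by rewrite !parmap_comp; congr parmap; apply/funext => i; rewrite /= sE.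
exists d; split=> [mu phi kmu muM|p phi pM|psi].
- by rewrite /mtmul cd measure_extP.
- by rewrite tmulP // cd type_extP.
(* Up to [iota], [tau \o s] sends [d] to [c] and an element [m] of [M] to [tau m], the entry [j m]
   of the realization of [q]. *)
rewrite (hiota psi (env d _)) -(holds_auto s) -(holds_auto tau).
rewrite (realizerP Sq) holds_parmap holds_fren.
rewrite (_ : tau \o _ = env (tau \o iota \o nbar) (iota \o c) \o
  (fun v => match v with inl i => inr i | inr m => inl (j m) end)) //.
apply/funext => -[i|m] /=; first by rewrite sE /= ainvK.
rewrite jE fs //; exists (val m) => //; exact: set_mem (valP m).
Qed.

End Extensions.
End Conjugation.

(** * Spaces of types and supports *)

Section TypeTopology.
Local Open Scope ring_scope.
Context {L : language} {S : structure L} {X P : Type} {par : P -> S}.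
Local Notation ST := (stype X par).
Implicit Types (p q : ST) (a b : fo L (X + P)).

Lemma cyl_open a : open (cyl a : set ST).
Proof. by move=> p pa; exists a; split. Qed.

Lemma nbhs_cylP p (U : set ST) : nbhs p U <-> exists a, p a /\ cyl a `<=` U.
Proof.
rewrite nbhsE; split=> [[V [oV Vp] VU]|[a [pa aU]]].
  by have [a [pa aV]] := oV p Vp; exists a; split=> //; exact: subset_trans VU.
by exists (cyl a) => //; split=> //; exact: cyl_open.
Qed.

Lemma st_fin p n (s : 'I_n -> fo L (X + P)) : (forall i, p (s i)) ->
  exists b : X -> S, forall i, holds (s i) (env b par).
Proof. by have [fp _] := st_is_type p; exact: fp. Qed.

Lemma st_not p a : p (fNot a) <-> ~ p a.
Proof.
split=> [pna pa|npa]; last by have [_ cp] := st_is_type p; case: (cp a).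
have [|b hb] := st_fin (p := p) (s := fun i : 'I_2 =>
  if val i == 0%N then a else fNot a); first by move=> i; case: ifP.
exact: (hb ord_max) (hb ord0).
Qed.

Lemma cylN a : cyl (fNot a) = ~` cyl a :> set ST.
Proof. by apply/seteqP; split=> p /st_not. Qed.

Lemma stype_eq p q : (forall a, p a <-> q a) -> p = q.
Proof.
case: p q => [p tp_] [q tq] /= pq.
have e : p = q by apply/funext => a; apply/propext; exact: pq.
by move: tp_; rewrite {}e => tp_; congr SType; exact: Prop_irrelevance.
Qed.

Lemma stype_hausdorff : hausdorff_space ST.
Proof.
rewrite open_hausdorff => p q /eqP pq.
have [a naq] : exists a, ~ (p a <-> q a).
  by apply/existsNP => h; apply: pq; exact: stype_eq.
have [pa|npa] := pselect (p a).
  have nqa : ~ q a by move=> qa; apply: naq.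
  exists (cyl a, cyl (fNot a)) => /=.
    by rewrite !inE; split=> //; exact/st_not.
  split; [exact: cyl_open|exact: cyl_open|apply/eqP].
  by rewrite cylN setICr.
have qa : q a by apply: contrapT => nqa; apply: naq.
exists (cyl (fNot a), cyl a) => /=.
  by rewrite !inE; split=> //; exact/st_not.
split; [exact: cyl_open|exact: cyl_open|apply/eqP].
by rewrite cylN setICl.
Qed.

(** The formulas whose cylinders belong to an ultrafilter form a complete type, which is its
    limit. *)
Lemma stype_compact : compact [set: ST].
Proof.
rewrite compact_ultra => F FU _.
pose r a := F (cyl a : set ST).
have r_type : is_type par r.
  split=> [n s rs|a]; last first.
    by case: (in_ultra_setVsetC (cyl a) FU); [left|right; rewrite /r cylN].
  have : F [set p : ST | forall i, p (s i)].
    exact: (@filter_forall _ _ (fun i => cyl (s i))).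
  by move=> /filter_ex[p /st_fin].
exists (SType r_type); split=> // U /nbhs_cylP[a [ra aU]].
exact: filterS ra.
Qed.

Lemma closed_stype_compact (A : set ST) : closed A -> compact A.
Proof. by move=> cA; exact: subclosed_compact cA stype_compact _. Qed.

End TypeTopology.

Lemma within_continuous_measurable (R : realType) L (S : structure L) (X : Type)
    (D : set (gtype X S)) (h : gtype X S -> R) :
  {within D, continuous h} -> measurable_fun (D : set (@borel_type L S X)) h.
Proof.
move=> /continuousP ch mD.
apply: (measurability _ (measurable_realfun.RGenOpens.measurableE R)) => //.
move=> _ [_ [a [b ->]] <-].
have oab : open (`]a, b[%classic : set R) by exact: interval_open.
have /open_subspaceP[V oV VD] := ch _ oab.
rewrite setIC -VD; apply: measurableI => //.
exact: sub_sigma_algebra.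
Qed.

(** * Mass and integrals on the support *)

Section Support.
Local Open Scope ring_scope.
Context {R : realType} {L : language} {S : structure L} {X : Type}.
Variable mu : fo L (X + S) -> R.
Hypothesis kmu : keisler mu.
Local Notation B := (@borel_type L S X).
Let P := borel_measure mu.
Hypothesis Pregular : regular_measure P.
Hypothesis Pcyl : forall a, P (cyl a) = (mu a)%:E.

Lemma supp_closed : closed (supp mu).
Proof.
rewrite -[supp mu]setCK closedC.
suff : st_open (~` supp mu) by [].
move=> p /existsNP[a /not_implyP[pa na]].
by exists a; split=> // q qa sq; exact/na/sq.
Qed.

Lemma open_borel (U : set B) : @open (gtype X S) U -> measurable U.
Proof. exact: sub_sigma_algebra. Qed.

Lemma closed_borel (F : set B) : @closed (gtype X S) F -> measurable F.
Proof.
move=> cF; rewrite -[F]setCK; apply: measurableC; apply: open_borel.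
exact: closed_openC.
Qed.

Lemma cyl_borel a : measurable (cyl a : set B).
Proof. by apply: open_borel; exact: cyl_open. Qed.

Lemma supp_borel : measurable (supp mu : set B).
Proof. by apply: closed_borel; exact: supp_closed. Qed.

Lemma borel_measureT : P setT = 1%E.
Proof.
have [_ mu1 _ _] := kmu.
rewrite (_ : setT = cyl fTrue).
  by rewrite Pcyl mu1 // => b; exact: id.
by apply/seteqP; split=> // p _; exact: st_true.
Qed.

(** By inner regularity only compact sets outside the support matter, and finitely many null
    cylinders cover such a set. *)
Lemma supp_full : P (~` supp mu) = 0%E.
Proof.
have mC : measurable (~` supp mu : set B) by apply: measurableC; exact: supp_borel.
have [_ ->] := Pregular mC.
apply/eqP; rewrite eq_le; apply/andP; split; last first.
  apply: ereal_sup_ubound; exists set0; rewrite ?measure0 //.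
  by split; [exact: compact0|exact: sub0set].
apply: ge_ereal_sup => _ [F [cF Fs] <-].
have := cF; rewrite compact_cover => /(_ {classic fo L (X + S)}
  [set a | mu a = 0] cyl) [a _|p /Fs /existsNP[a /not_implyP[pa na]]|D' D'0 FD'].
- exact: cyl_open.
- exists a => //=; apply/eqP; rewrite eq_le leNgt; apply/andP; split; first exact/negP.
  by have [] := kmu.
have [mU U0] : measurable (\big[setU/set0]_(i <- finmap.enum_fset D') cyl i : set B) /\
    P (\big[setU/set0]_(i <- finmap.enum_fset D') cyl i) = 0%E.
  pose Z (U : set B) := measurable U /\ P U = 0%E.
  rewrite -/(Z _) big_seq; apply: (big_ind Z) => [|U V [mU U0] [mV V0]|a /D'0].
  - by split; [exact: measurable0|rewrite measure0].
  - by split; [exact: measurableU|exact: null_set_setU].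
  - by rewrite inE /= => a0; split; [exact: cyl_borel|rewrite Pcyl a0].
rewrite -U0; apply: le_measure; rewrite ?inE //.
  by apply: closed_borel; exact: compact_closed stype_hausdorff cF.
by rewrite -bigcup_fset.
Qed.

Lemma mu_gt0_supp a : 0 < mu a -> exists2 p, supp mu p & p a.
Proof.
move=> a0; apply: contrapT => na.
have : (P (cyl a) <= P (~` supp mu))%E.
  apply: le_measure; rewrite ?inE.
  - exact: cyl_borel.
  - by apply: measurableC; exact: supp_borel.
  - by move=> p pa sp; apply: na; exists p.
by rewrite Pcyl supp_full lee_fin leNgt a0.
Qed.

(** The strict inequality at [p0] persists, with a margin [e], on a cylinder [a] around it. As
    [mu a > 0], the integral is at most [A - e * mu a]. *)
Lemma Rintegral_supp_lt (D : set (gtype X S)) (h : gtype X S -> R) A p0 :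
  closed D -> supp mu `<=` D -> {within D, continuous h} ->
  (forall p, D p -> `|h p| <= 1) ->
  (forall p, supp mu p -> h p <= A) -> supp mu p0 -> h p0 < A ->
  \int[P]_(q in D) h q < A.
Proof.
move=> cD sD ch hb hA sp0 hp0.
have mD : measurable (D : set B) by exact: closed_borel.
have mE : measurable (supp mu : set B) by exact: supp_borel.
have Pfin (U : set B) : measurable U -> (P U < +oo)%E.
  move=> mU; apply: (@le_lt_trans _ _ (P setT)); last by rewrite borel_measureT ltry.
  by apply: le_measure; rewrite ?inE.
have ih : P.-integrable (D : set B) (EFin \o h).
  apply: measurable_bounded_integrable => //; first exact: Pfin.
    exact: within_continuous_measurable.
  exists 1; split=> // x x1 p /= Dp; exact: le_trans (hb p Dp) (ltW x1).
have ihE (U : set B) : measurable U -> U `<=` supp mu ->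
    P.-integrable (U : set B) (EFin \o h).
  by move=> mU UE; apply: integrableS ih => //; exact: subset_trans sD.
rewrite /Rintegral
  (@negligible_integral _ B R P (D : set B) (~` supp mu) (EFin \o h)) //;
  last 2 first.
- exact: measurableC.
- exact: supp_full.
rewrite setDE setCK setIidr //.
pose e := (A - h p0) / 2.
have e0 : 0 < e by rewrite divr_gt0 // subr_gt0.
have : nbhs p0 [set p | D p -> h p < A - e].
  have /subspace_continuousP/(_ p0 (sD _ sp0)) := ch.
  move=> /(_ [set y | y < A - e]); apply.
  apply: open_nbhs_nbhs; split; first exact: open_lt.
  by rewrite /= ltrBrDr -ltrBrDl ltr_pdivrMr // ltr_pMr ?ltr1n // subr_gt0.
move=> /nbhs_cylP[a [p0a aU]].
have mu_a : 0 < mu a by exact: sp0.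
have ma : measurable (cyl a : set B) by exact: cyl_borel.
have mEa : measurable (supp mu `&` cyl a : set B) by exact: measurableI.
have mEDa : measurable (supp mu `\` cyl a : set B) by exact: measurableD.
have icst (U : set B) c : measurable U -> P.-integrable U (EFin \o cst c).
  move=> mU; apply: measurable_bounded_integrable => //; first exact: Pfin.
  exists `|c|; split=> // x /ltW cx p _ /=; exact: cx.
have PE : (fine (P (supp mu `&` cyl a)) + fine (P (supp mu `\` cyl a)) = 1)%R.
  rewrite -fineD ?ge0_fin_numE ?Pfin // -measureU //; last first.
    by rewrite setDE setIACA setICr setI0.
  rewrite setUIDK; have := borel_measureT; rewrite -(setUv (supp mu)).
  rewrite measureU0 //; [by move/(congr1 fine)|exact: measurableC|exact: supp_full].
have PEa : fine (P (supp mu `&` cyl a)) = mu a.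
  have : P (cyl a) = P (supp mu `&` cyl a).
    rewrite -[in LHS](setUIDK (cyl a) (supp mu)) setIC measureU0 //.
      exact: measurableD.
    apply: (subset_measure0 _ _ _ supp_full); [exact: measurableD|
      exact: measurableC|by move=> p []].
  by rewrite Pcyl => <-.
rewrite -/(Rintegral P (supp mu) h) -[in X in X < _](setUIDK (supp mu) (cyl a)).
rewrite Rintegral_setU //; last 2 first.
- by rewrite setUIDK; exact: ihE.
- by apply/disj_setPS => p [[_ pa] []].
apply: (@le_lt_trans _ _ ((A - e) * mu a + A * (1 - mu a))).
  apply: lerD.
    rewrite -PEa -Rintegral_cst //; apply: le_Rintegral => //.
    - by apply: ihE => // p [].
    - exact: icst.
    - by move=> p [sp pa]; apply/ltW/(aU _ pa)/sD.
  have <- : fine (P (supp mu `\` cyl a)) = 1 - mu a.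
    by rewrite -PEa -PE addrAC subrr add0r.
  rewrite -Rintegral_cst //.
  apply: le_Rintegral => //; [by apply: ihE => // p []|exact: icst|].
  by move=> p [sp _]; exact: hA.
rewrite mulrBl mulrBr mulr1 addrAC [_ + (A - _)]addrC subrK gtrBl.
by rewrite mulr_gt0.
Qed.

End Support.

(** * Idempotent measures *)

Section Keisler.
Local Open Scope ring_scope.
Context {R : realType} {L : language} {S : structure L} {X : Type}.
Variable mu : fo L (X + S) -> R.
Hypothesis kmu : keisler mu.

Lemma keisler_true : mu fTrue = 1.
Proof. by have [_ mu1 _ _] := kmu; apply: mu1 => b; exact: id. Qed.

Lemma keisler_not a : mu (fNot a) = 1 - mu a.
Proof.
have [_ mu1 _ muD] := kmu.
have <- : mu (fOr a (fNot a)) = 1 by apply: mu1 => b; exact: id.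
rewrite muD; first by rewrite addrAC subrr add0r.
by move=> e /holds_and[ha]; exact.
Qed.

End Keisler.

Section Ideals.
Local Open Scope ring_scope.
Context {R : realType} {L : language} {K K' : Type} {C C' : structure L}.
Context {iota : C -> C'} {I : Type} {nbar : I -> C} {J : set I}.
Variable mu : fo L (I + C) -> R.
Hypotheses (hmon : monster K C) (hmon' : monster K' C').
Hypothesis hiota : elementary_embedding iota.
Hypotheses (hKK' : [set: K] #<= [set: K']) (hCK' : card_lt C K').
Hypothesis hI : card_lt I K.
Hypothesis hmu : Mdf_nbar nbar (nbar @` J) mu.
Hypothesis hidem : mconv iota nbar (nbar @` J) mu mu = mu.
Hypothesis hsupp : supp mu `<=` Sinv_nbar nbar (nbar @` J).

Let M := nbar @` J.
Let mul := tmul iota nbar M.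
Let E := supp mu.
Let f a q := mtmul iota nbar M mu q a.

Let kmu : keisler mu. Proof. by case: hmu. Qed.
Let muM : measure_invariant M mu. Proof. by case: hmu => _ []. Qed.
Let ES p : E p -> S_nbar nbar p. Proof. by move=> /hsupp[]. Qed.
Let EM p : E p -> type_invariant M p. Proof. by move=> /hsupp[]. Qed.

(** The total mass 1 required by [Mdf_nbar] excludes the zero measure, the default of [xget]. *)
Lemma borel_measureP : regular_measure (borel_measure mu) /\
  forall a, borel_measure mu (cyl a) = (mu a)%:E.
Proof.
have [_ _] := hmu; rewrite /borel_measure; case: xgetP => [P -> //|_].
by move=> /esym/eqP; rewrite /mzero /= onee_eq0.
Qed.

Let Pregular := proj1 borel_measureP.
Let Pcyl := proj2 borel_measureP.

Lemma base_index : exists j : M -> I, forall m, nbar (j m) = val m.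
Proof.
have /choice[j jE] (m : M) : exists i, nbar i = val m.
  by have [i _ im] : M (val m) := set_mem (valP m); exists i.
by exists j.
Qed.

Lemma card_lt_base : card_lt M K.
Proof.
have [j jE] := base_index; apply: card_le_lt hI; apply/card_le_injP.
by exists j => x y xy; apply: val_inj; rewrite -!jE xy.
Qed.

Definition base_vars n (psi : fo L ('I_n + M)) : fo L (I + 'I_n) :=
  swap_vars (sval (cid base_index)) psi.

(** Right multiplication by [q] replaces the parameters [c] by [d]; the last clause reads the type
    of [d] over [M] off [q]. All computations with products go through this relation. *)
Definition shift (q : gtype I C) n (c d : 'I_n -> C) := [/\
  forall phi, f (parmap c phi) q = mu (parmap d phi),
  forall p phi, type_invariant M p ->
    mul p q (parmap c phi) <-> p (parmap d phi) &
  forall psi : fo L ('I_n + M),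
    holds psi (env d set_val) <-> q (parmap c (base_vars psi))].

Lemma shift_exists q n (c : 'I_n -> C) : S_nbar nbar q -> exists d, shift q c d.
Proof.
move=> Sq; have jE := svalP (cid base_index).
have [d [mud pd psid]] :=
  mul_shift (R := R) hmon hmon' hiota hKK' card_lt_base hI hCK' jE c Sq.
by exists d; split=> // phi; exact: mud.
Qed.

Lemma shift_formula a q : S_nbar nbar q ->
  exists n (c d : 'I_n -> C) (phi : fo L (I + 'I_n)),
  a = parmap c phi /\ shift q c d.
Proof.
move=> Sq; have [n [c [phi /(_ ord0) aE]]] := parmap_support (fun _ : 'I_1 => a).
by have [d sd] := shift_exists c Sq; exists n, c, d, (phi ord0).
Qed.

Lemma S_nbar_closed : closed (S_nbar nbar).
Proof.
rewrite -[S_nbar nbar]setCK closedC.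
suff : st_open (~` S_nbar nbar) by [].
move=> p /existsNP[a /not_implyP[pa na]].
exists (fNot (fren inl a)); split; first exact/st_not.
by move=> q /st_not qa Sq; exact/qa/Sq.
Qed.

Lemma mul_S_nbar p q : type_invariant M p -> S_nbar nbar p -> S_nbar nbar q ->
  S_nbar nbar (mul p q).
Proof.
move=> pM Sp Sq a ha.
have c0 (i : 'I_0) : C by case: i.
have cE (c : 'I_0 -> C) : parmap c (fren inl a) = fren inl a.
  by rewrite /parmap fren_comp.
have [d [_ pd _]] := shift_exists c0 Sq.
by rewrite -(cE c0) pd // cE; exact: Sp.
Qed.

(** Definability makes the value a continuous function [F] of the type of [d] over [M]; a basic
    neighbourhood [psi] of that type pulls back to the cylinder of [base_vars psi] at [c]. *)
Lemma mtmul_continuous a : {within S_nbar nbar, continuous (f a)}.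
Proof.
have [n [c [phi /(_ ord0) ->]]] := parmap_support (fun _ : 'I_1 => a).
have [_ [_ /(_ n (phi ord0))[F [cF FE]]] _] := hmu.
apply/subspace_continuousP => q Sq W.
have [d [fd _ psid]] := shift_exists c Sq.
move=> Wq; have {}Wq : nbhs (f (parmap c (phi ord0)) q) W := Wq.
move: Wq; rewrite fd FE => /cF /nbhs_cylP[psi [/= dpsi psiW]].
apply/nbhs_cylP; exists (parmap c (base_vars psi)); split; first exact/psid.
move=> q' q'psi Sq'; have [d' [fd' _ psid']] := shift_exists c Sq'.
suff : W (f (parmap c (phi ord0)) q') by [].
by rewrite fd' FE; apply: psiW; apply/psid'.
Qed.

Lemma mulr_continuous q : E q -> {within E, continuous (mul^~ q)}.
Proof.
move=> Eq; apply/subspace_continuousP => p Ep W.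
rewrite nbhs_simpl /= => /nbhs_cylP[a [pqa aW]].
have [n [c [d [phi [aE [_ pd _]]]]]] := shift_formula a (ES Eq).
apply/nbhs_cylP; exists (parmap d phi); split.
  by rewrite -pd -?aE //; exact: EM.
move=> p' p'd Ep'; apply: aW; rewrite /cyl /= aE; apply/pd => //; exact: EM.
Qed.

Lemma mtmul_ge0 a q : S_nbar nbar q -> 0 <= f a q.
Proof.
move=> Sq; have [n [c [d [phi [-> [-> _ _]]]]]] := shift_formula a Sq.
by have [mu0 _ _ _] := kmu.
Qed.

Lemma mtmul_not a q : S_nbar nbar q -> f (fNot a) q = 1 - f a q.
Proof.
move=> Sq; have [n [c [d [phi [-> [fd _ _]]]]]] := shift_formula a Sq.
by rewrite -[fNot _]/(parmap c (fNot phi)) !fd -keisler_not.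
Qed.

Lemma mtmul_norm_le1 a q : S_nbar nbar q -> `|f a q| <= 1.
Proof.
move=> Sq; rewrite ger0_norm ?mtmul_ge0 // -subr_ge0 -mtmul_not //; exact: mtmul_ge0.
Qed.

(** Idempotence writes [mu a] as the integral of [f a], to which the strict integral bound
    applies. *)
Lemma supp_max_lt a A p0 : (forall p, E p -> f a p <= A) -> E p0 -> f a p0 < A ->
  mu a < A.
Proof.
move=> fA Ep0 fp0.
have <- : mconv iota nbar M mu mu a = mu a by rewrite hidem.
exact: (Rintegral_supp_lt kmu Pregular Pcyl S_nbar_closed ES (@mtmul_continuous a)
  (@mtmul_norm_le1 a) fA Ep0 fp0).
Qed.

(** Both [b] and [e] satisfy [psi] exactly when [mul p q] contains its swapped form at [c], so they
    have the same type over [M]. Associativity of both products rests on this. *)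
Lemma shift_mul p q n (c d e b : 'I_n -> C) : E p -> E q ->
  shift q c d -> shift p d e -> shift (mul p q) c b ->
  exists s : auto C, fixes M s /\ s \o b = e.
Proof.
move=> Ep Eq [_ pd _] [_ _ pe] [_ _ pb].
apply: (same_type_conj hmon card_lt_base); first exact: card_lt_ord hmon _.
by move=> psi; rewrite pb pe; apply: pd; exact: EM.
Qed.

Lemma mtmul_mul p q n (c d : 'I_n -> C) phi : E p -> E q -> shift q c d ->
  f (parmap c phi) (mul p q) = f (parmap d phi) p.
Proof.
move=> Ep Eq sd.
have [e se] := shift_exists d (ES Ep).
have [b sb] := shift_exists c (mul_S_nbar (EM Ep) (ES Ep) (ES Eq)).
have [s [fs be]] := shift_mul Ep Eq sd se sb.
by have [-> _ _] := se; have [-> _ _] := sb; rewrite -be -parmap_comp muM.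
Qed.

(* The maximum principle for the harmonic function [f a]. *)
Lemma mtmul_max_lt a A q p0 : E q -> (forall p, E p -> f a (mul p q) <= A) -> E p0 ->
  f a (mul p0 q) < A -> f a q < A.
Proof.
move=> Eq; have [n [c [d [phi [-> sd]]]]] := shift_formula a (ES Eq).
move=> fA Ep0 fp0; have [-> _ _] := sd.
apply: (supp_max_lt (p0 := p0)) => // [p Ep|]; rewrite -(mtmul_mul _ _ _ sd) //.
exact: fA.
Qed.

(** If [a] is in [mul p q], then [f a q > 0], so [f (fNot a)] is below 1 at the point [q] of the
    support. Averaging gives [mu (fNot a) < 1], that is [mu a > 0]. *)
Lemma mul_supp p q : E p -> E q -> E (mul p q).
Proof.
move=> Ep Eq a; have [n [c [d [phi [-> [fd pd _]]]]]] := shift_formula a (ES Eq).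
move=> /pd -/(_ (EM Ep)) /Ep; rewrite -fd => fq0.
suff : mu (fNot (parmap c phi)) < 1.
  by rewrite keisler_not // ltrBlDr ltrDl.
apply: (supp_max_lt (p0 := q)) => // [r Er|].
  exact: le_trans (ler_norm _) (mtmul_norm_le1 _ (ES Er)).
by rewrite mtmul_not; [rewrite ltrBlDr ltrDl|exact: ES].
Qed.

Lemma mulA s p q : E s -> E p -> E q -> mul s (mul p q) = mul (mul s p) q.
Proof.
move=> Es Ep Eq; apply: stype_eq => a.
have [n [c [d [phi [-> sd]]]]] := shift_formula a (ES Eq).
have [e se] := shift_exists d (ES Ep).
have [b sb] := shift_exists c (ES (mul_supp Ep Eq)).
have [t [ft be]] := shift_mul Ep Eq sd se sb.
have [_ sbP _] := sb; have [_ sdP _] := sd; have [_ seP _] := se.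
rewrite sbP; last exact: EM.
rewrite sdP; last exact/EM/mul_supp.
have -> : s (parmap b phi) <-> s (parmap e phi); last first.
  exact: iff_sym (seP s phi (EM Es)).
rewrite -be -parmap_comp; exact: iff_sym (EM Es ft (parmap b phi)).
Qed.

Lemma supp_neq0 : E !=set0.
Proof.
have [|p Ep _] := mu_gt0_supp kmu Pregular Pcyl (a := fTrue).
  by rewrite keisler_true.
by exists p.
Qed.

Lemma supp_compact : compact E.
Proof. exact/closed_stype_compact/supp_closed. Qed.

Lemma supp_left_ideal : left_ideal mul E E.
Proof. by split=> //; [exact: supp_neq0|exact: mul_supp]. Qed.

(** * Left ideals of the support *)

Definition maximizers a := [set q | E q /\ forall r, E r -> f a r <= f a q].

(** Compactness gives a maximizer [q]. If [mul s q] were not maximal, the maximum principle with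
    bound [f a q] would yield [f a q < f a q]. *)
Lemma maximizers_left_ideal a : left_ideal mul E (maximizers a).
Proof.
split=> [|q []//|s q Es [Eq maxq]].
  have [|q /set_mem Eq maxq] := compact_EVT_max supp_neq0 supp_compact (f := f a).
    by apply: (@continuous_subspaceW _ _ _ (S_nbar nbar)); [exact: ES|exact: mtmul_continuous].
  by exists q; split=> // r Er; apply: maxq; exact/mem_set.
split=> [|r Er]; first exact: mul_supp.
apply: (le_trans (maxq r Er)); rewrite leNgt; apply/negP => sq.
have := mtmul_max_lt Eq (fun p Ep => maxq _ (mul_supp Ep Eq)) Es sq.
by rewrite ltxx.
Qed.

Lemma right_translate_closed q : E q -> closed (mul^~ q @` E).
Proof.
move=> Eq; apply: compact_closed; first exact: stype_hausdorff.
exact: continuous_compact (mulr_continuous Eq) supp_compact.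
Qed.

Lemma closed_separation (F : set (gtype I C)) r : closed F -> ~ F r ->
  exists2 a, r a & forall p, F p -> ~ p a.
Proof.
move=> cF nFr; have oF : open (~` F) by exact: closed_openC.
have /nbhs_cylP[a [ra aF]] : nbhs r (~` F) by exact: open_nbhs_nbhs.
by exists a => // p Fp /aF.
Qed.

Lemma mtmul_gt0_mul a q : E q -> 0 < f a q -> exists2 p, E p & mul p q a.
Proof.
move=> Eq; have [n [c [d [phi [-> [-> pd _]]]]]] := shift_formula a (ES Eq).
move=> /(mu_gt0_supp kmu Pregular Pcyl)[p Ep pp]; exists p => //.
by apply/pd => //; exact: EM.
Qed.

Lemma stab_left_simple : E `<=` stab_r iota nbar M mu -> left_simple mul E.
Proof.
move=> stab B [[q Bq] BE Bl]; apply/seteqP; split=> // r Er.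
have Eq := BE _ Bq.
(* The right translate of the support by [q] lies in [B]. A point [r] outside it would have a
   cylinder [a] missing this closed set, although [f a q = mu a > 0]. *)
have [[p Ep <-]|nr] := pselect ((mul^~ q @` E) r); first exact: Bl.
have [a ra na] := closed_separation (right_translate_closed Eq) nr.
have [|p Ep pqa] := mtmul_gt0_mul (a := a) Eq.
  by have [_] := stab _ Eq; rewrite /f => ->; exact: Er.
by case: (na (mul p q)) => //; exists p.
Qed.

Lemma left_simple_stab : left_simple mul E -> E `<=` stab_r iota nbar M mu.
Proof.
move=> simple q Eq; split; first exact: ES.
have fle a r : E r -> f a r <= f a q.
  move=> Er; have : maximizers a q by rewrite (simple _ (maximizers_left_ideal a)).
  by case=> _; exact.
have mule a : mu a <= f a q.
  (* The bound of [supp_max_lt] is strict, hence the slack [e] above the maximum [f a q]. *)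
  apply/ler_addgt0Pr => e e0; apply: ltW; apply: (supp_max_lt _ Eq).
    by move=> p Ep; rewrite (le_trans (fle a p Ep)) // lerDl ltW.
  by rewrite ltrDl.
apply/funext => a; apply/eqP; rewrite eq_le mule andbT.
(* The same bound for the negation is the reverse inequality. *)
have := mule (fNot a); rewrite keisler_not // mtmul_not; last exact: ES.
by rewrite lerD2l lerN2.
Qed.

Lemma left_simple_minimal : left_simple mul E -> minimal_left_ideal mul E E.
Proof. by move=> simple; split=> [|B lB _]; [exact: supp_left_ideal|exact: simple]. Qed.

(** A left ideal inside the translate pulls back along right multiplication by [r] to a left ideal
    inside [L0], which is all of [L0] by minimality. *)
Lemma minimal_left_ideal_mulr L0 r : minimal_left_ideal mul E L0 -> E r ->
  minimal_left_ideal mul E (mul^~ r @` L0).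
Proof.
move=> [[L00 LE Ll] Lmin] Er; split.
  split=> [|_ [l Ll0 <-]|s _ Es [l Ll0 <-]].
  - by case: L00 => l Ll0; exists (mul l r); exists l.
  - by apply: mul_supp => //; exact: LE.
  - exists (mul s l); first exact: Ll.
    by rewrite mulA //; exact: LE.
move=> B [[b Bb] BE Bl] BL; apply/seteqP; split=> // _ [l Ll0 <-].
suff LB : [set l' | L0 l' /\ B (mul l' r)] = L0.
  by move: Ll0; rewrite -{1}LB => -[].
apply: Lmin; last by move=> l' [].
split=> [|l' [/LE]//|s l' Es [Ll' Bl']].
  by have [l' Ll' l'b] := BL _ Bb; exists l'; split=> //; rewrite l'b.
split; first exact: Ll.
by rewrite -mulA //; [exact: Bl|exact: LE].
Qed.

Lemma unique_minimal_eq L0 : unique (minimal_left_ideal mul E) L0 -> E = L0.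
Proof.
move=> [minL uniqL]; have [[[q Lq] LE Ll] Lmin] := minL.
have Eq := LE _ Lq.
(* Minimality makes [L0] a right translate of the compact support, hence closed. *)
have LEq : mul^~ q @` E = L0.
  apply: Lmin; last by move=> _ [p Ep <-]; exact: Ll.
  split=> [|_ [p Ep <-]|s _ Es [p Ep <-]].
  - by exists (mul q q); exists q.
  - exact: mul_supp.
  - by exists (mul s p); [exact: mul_supp|rewrite mulA].
(* Right translates of [L0] are minimal left ideals, so uniqueness makes [L0] two-sided. *)
have Lr l r : L0 l -> E r -> L0 (mul l r).
  by move=> Ll0 Er; rewrite (uniqL _ (minimal_left_ideal_mulr minL Er)); exists l.
apply/seteqP; split=> // r Er; apply: contrapT => nr.
have [a ra na] : exists2 a, r a & forall p, L0 p -> ~ p a.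
  by apply: closed_separation => //; rewrite -LEq; exact: right_translate_closed.
have f0 l : L0 l -> f a l <= 0.
  move=> Ll0; rewrite leNgt; apply/negP => /(mtmul_gt0_mul (LE _ Ll0))[p Ep].
  by apply: na; exact: Ll.
(* [mul q z] maximizes [f a] and lies in [L0], where [f a] is at most 0, so [f a] is nowhere
   positive on the support. *)
have [[z [Ez maxz]] _ Zl] := maximizers_left_ideal a.
have [_ maxqz] := Zl q z Eq (conj Ez maxz).
have fle p : E p -> f a p <= 0.
  by move=> Ep; apply: le_trans (maxqz p Ep) _; apply: f0; exact: Lr.
have : mu a < mu a.
  apply: (supp_max_lt _ Eq) => [p Ep|]; first exact: le_trans (fle p Ep) (ltW (Er a ra)).
  exact: le_lt_trans (fle q Eq) (Er a ra).
by rewrite ltxx.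
Qed.

End Ideals.

Theorem theorem3p9 (R : realType) (L : language) (T : set (fo L void))
  (K K' : Type) (C C' : structure L) (iota : C -> C')
  (I : Type) (nbar : I -> C) (J : set I) (mu : fo L (I + C) -> R)
  (hT : complete_theory T) (hC : models C T)
  (hmon : monster K C) (hmon' : monster K' C')
  (hiota : elementary_embedding iota)
  (hKK' : [set: K] #<= [set: K']) (hCK' : card_lt C K')
  (hI : card_lt I K)
  (hMN : elementary_sub (nbar @` J) (range nbar))
  (hNC : elementary_sub (range nbar) [set: C])
  (hmu : Mdf_nbar nbar (nbar @` J) mu)
  (hidem : mconv iota nbar (nbar @` J) mu mu = mu)
  (hsupp : supp mu `<=` Sinv_nbar nbar (nbar @` J)) :
  let mul := tmul iota nbar (nbar @` J) in
  [/\ supp mu `<=` stab_r iota nbar (nbar @` J) mu <->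
        left_simple mul (supp mu),
      left_simple mul (supp mu) <->
        exists! L0, minimal_left_ideal mul (supp mu) L0
    & forall L0, unique (minimal_left_ideal mul (supp mu)) L0 ->
        supp mu = L0].

Proof.
move=> mul; set E := supp mu; set M := nbar @` J.
have simple_unique : left_simple mul E ->
    unique (minimal_left_ideal mul E) E.
  move=> simple; split.
    exact: (left_simple_minimal hmon hmon' hiota hKK' hCK' hI hmu hidem hsupp simple).
  by move=> L0 [lL0 _]; rewrite (simple _ lL0).
have unique_supp L0 : unique (minimal_left_ideal mul E) L0 -> E = L0.
  exact: (unique_minimal_eq hmon hmon' hiota hKK' hCK' hI hmu hidem hsupp).
split; [split|split|exact: unique_supp].
- exact: (stab_left_simple hmon hmon' hiota hKK' hCK' hI hmu hsupp).
- exact: (left_simple_stab hmon hmon' hiota hKK' hCK' hI hmu hidem hsupp).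
- by move=> /simple_unique uE; exists E.
- move=> [L0 uL0] B lB; have [[_ Lmin] _] := uL0.
  (* Once [L0] is the whole support, every left ideal lies inside it, and minimality is
     left-simplicity. *)
  have EL0 := unique_supp _ uL0; rewrite [RHS]EL0; apply: Lmin => //.
  by rewrite -EL0; case: lB.
Qed.
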